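(* Let $d\ge1$, $m\ge1$ be integers, $B>0$, $N\ge1$ an integer and $n=N^d$. Divide $\mathcal X=[0,1]^d$ into $n$ equal axis-aligned cubes $\mathcal X_1,\dots,\mathcal X_n$ of side $1/N$ with centers $x^{(1)},\dots,x^{(n)}$ (boundary points assigned to an arbitrary adjacent cube), and for $f:\mathcal X\to\mathbb R$ let $g_n$ be the function equal to $f(x^{(i)})$ on $\mathcal X_i$. Then \[\sup_{f\in\mathcal F_{d,m,B}}|L_f-L_{g_n}|=\begin{cases}\Theta_{m,d}(Bn^{-1/d}),&\text{if }m=1\text{ or }Bn^{-1/d}>1,\\ \Theta_{m,d}(\max\{B,B^2\}n^{-2/d}),&\text{otherwise},\end{cases}\] and $\sup_{f\in\mathcal F_{d,m,B}}D_{\sup\text{-}\log}(P_f,P_{g_n})=\Theta_{m,d}(Bn^{-1/d})$.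
   Context: For bounded measurable $f:\mathcal X\to\mathbb R$: $Z_f=\int_{\mathcal X}e^f dx$, $L_f=\log Z_f$, $P_f$ the distribution with density $e^f/Z_f$. $\|f\|_{C^m}=\sup_{\alpha\in\mathbb N_0^d,|\alpha|_1\le m}\|\partial^\alpha f\|_\infty$ and $\mathcal F_{d,m,B}=\{f\in C^m(\mathcal X):\|f\|_{C^m}\le B\}$. $D_{\sup\text{-}\log}(P,Q)=\|\log(dP/dQ)\|_\infty$ (essential sup; $\infty$ unless mutually absolutely continuous). $\Theta_{m,d}$: the two sides are bounded by each other up to positive constants depending only on $m,d$, uniformly in $B>0$ and $n$ (within the stated case). *)

(* Defs.v *)
From HB Require Import structures.
From mathcomp Require Import all_boot all_order all_algebra.
From mathcomp Require Import all_classical all_reals all_analysis.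
Set Implicit Arguments. Unset Strict Implicit. Unset Printing Implicit Defensive.
Import Order.TTheory GRing.Theory Num.Theory.
Import numFieldNormedType.Exports.
Local Open Scope classical_set_scope.
Local Open Scope ring_scope.

Section Defs.
Variable R : realType.

Definition cubeX (d : nat) : set 'rV[R]_d :=
  [set x | forall j : 'I_d, 0 <= x ord0 j <= 1].
Definition cubeXo (d : nat) : set 'rV[R]_d :=
  [set x | forall j : 'I_d, 0 < x ord0 j < 1].

Definition evec (d : nat) (j : 'I_d) : 'rV[R]_d := delta_mx ord0 j.

Fixpoint pder (d : nat) (s : seq 'I_d) (f : 'rV[R]_d -> R) : 'rV[R]_d -> R :=
  match s with
  | [::] => f
  | i :: s' => fun x => derive (pder s' f) x (evec i)
  end.

(* F_{d,m,B} = { f in C^m(X) : ||f||_{C^m} <= B }.  C^m on the closed cube: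
   all partial derivatives of order <= m exist on the interior and extend
   continuously to X; the C^m norm is the sup of |d^alpha f| over X. *)
Definition inF (d m : nat) (B : R) (f : 'rV[R]_d -> R) : Prop :=
  {within (@cubeX d), continuous f} /\
  (forall x, (@cubeX d) x -> `|f x| <= B) /\
  (forall (s : seq 'I_d) (i : 'I_d), (size s < m)%N ->
     forall x, (@cubeXo d) x -> derivable (pder s f) x (evec i)) /\
  (forall s : seq 'I_d, (size s <= m)%N ->
     (exists G : 'rV[R]_d -> R, {within (@cubeX d), continuous G} /\
        forall x, (@cubeXo d) x -> G x = pder s f x) /\
     (forall x, (@cubeXo d) x -> `|pder s f x| <= B)).

(* Lebesgue integral over [0,1]^d of a nonnegative function, as an iterated
   (Tonelli) integral of one-dimensional Lebesgue integrals *)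
Fixpoint cint (d : nat) : ('rV[R]_d -> \bar R) -> \bar R :=
  match d return ('rV[R]_d -> \bar R) -> \bar R with
  | 0 => fun h => h 0
  | S d' => fun h =>
      (\int[lebesgue_measure]_(t in `[0%R, 1%R]%classic)
         cint (fun y : 'rV[R]_d' => h (row_mx (const_mx t : 'rV[R]_1) y)))%E
  end.

Definition Zf (d : nat) (f : 'rV[R]_d -> R) : R :=
  fine (cint (fun x => (expR (f x))%:E)).
Definition Lf (d : nat) (f : 'rV[R]_d -> R) : R := ln (Zf f).
Definition densP (d : nat) (f : 'rV[R]_d -> R) (x : 'rV[R]_d) : R :=
  expR (f x) / Zf f.

(* D_sup-log(P_f, P_g) = ess sup_{x in X} |log (dP_f/dP_g)(x)|, where
   dP_f/dP_g = densP f / densP g (both densities are positive on X) *)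
Definition Dsuplog (d : nat) (f g : 'rV[R]_d -> R) : \bar R :=
  ereal_inf [set c%:E | c in
    [set c : R | cint (fun x =>
       (\1_[set y | c < `|ln (densP f y / densP g y)|] x)%:E) = 0%E]].

(* grid of n = N^d cubes of side 1/N; a cube is indexed by k : 'I_d -> 'I_N,
   the cube k is prod_j [k_j/N, (k_j+1)/N], its center has coordinates
   (k_j + 1/2)/N.  An assignment asg picks for each x in X a cube containing
   it (arbitrary on boundaries). *)
Definition valid_asg (d N : nat) (asg : 'rV[R]_d -> 'I_d -> 'I_N) : Prop :=
  forall x, (@cubeX d) x -> forall j : 'I_d,
    (asg x j)%:R / N%:R <= x ord0 j <= ((asg x j)%:R + 1) / N%:R.

Definition center (d N : nat) (k : 'I_d -> 'I_N) : 'rV[R]_d :=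
  \row_(j < d) (((k j)%:R + 2^-1) / N%:R).

Definition gn (d N : nat) (asg : 'rV[R]_d -> 'I_d -> 'I_N)
  (f : 'rV[R]_d -> R) : 'rV[R]_d -> R := fun x => f (center (asg x)).

Definition supL (d m N : nat) (B : R) (asg : 'rV[R]_d -> 'I_d -> 'I_N) : \bar R :=
  ereal_sup [set (`|Lf f - Lf (gn asg f)|)%:E | f in [set f | inF m B f]].
Definition supD (d m N : nat) (B : R) (asg : 'rV[R]_d -> 'I_d -> 'I_N) : \bar R :=
  ereal_sup [set Dsuplog f (gn asg f) | f in [set f | inF m B f]].

End Defs.

(* Main.v *)
Require Import Defs.
From HB Require Import structures.
From mathcomp Require Import all_boot all_order all_algebra.
From mathcomp Require Import all_classical all_reals all_analysis.
From mathcomp Require Import measurable_realfun ring lra.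
Import Order.TTheory GRing.Theory Num.Theory.
Import numFieldNormedType.Exports.
Local Open Scope classical_set_scope.
Local Open Scope ring_scope.

(* Both [Zf] and [Zf (gn _ f)] factor over coordinates: the first is an iterated
   integral, the second is the iterated midpoint rule of [expR \o f] ([csum]), because
   the cell boundaries are null. It therefore suffices to compare, along each
   coordinate line, the integral of [exp phi] over [0, 1] with its midpoint sum, up to
   a factor [exp (+- e)]; the [d] factors multiply. The Lipschitz bound gives
   [e = B / 2N]. For [m >= 2] and [B <= N] a second-order Taylor expansion at the cell
   center, whose linear term integrates to zero, gives [e] of order
   [max(B, B^2) / N^2].

   The lower bounds use functions of the first coordinate only:
   [B / 8N * cos (2 pi N x)] when [m = 1], which takes its minimum at every cell center,
   and [B / 3 * (x + x^2)] otherwise. On each cell the exponential is compared with a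
   quadratic polynomial, which the midpoint rule underestimates. *)

Set Implicit Arguments.
Unset Strict Implicit.
Unset Printing Implicit Defensive.

(** * Integrals over the unit interval *)

Section UnitInterval.
Variable R : realType.
Notation mu := (@lebesgue_measure R).
Implicit Types (f g F : R -> R) (N : nat).

(* Monotonicity with no measurability assumption: the integral of a nonnegative
   function is a supremum over the simple functions below it. *)
Lemma le_integral_nonmeasurable (D : set R) (f g : R -> \bar R) :
  (forall x, D x -> (0 <= f x)%E) -> (forall x, D x -> (f x <= g x)%E) ->
  (\int[mu]_(x in D) f x <= \int[mu]_(x in D) g x)%E.
Proof.
move=> f0 fg.
have g0 x : D x -> (0 <= g x)%E by move=> Dx; exact: le_trans (f0 _ Dx) (fg _ Dx).
rewrite !ge0_integralE//; apply: le_ereal_sup => _ [h /= hf <-].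
exists h => // x; apply: le_trans (hf x) _.
by rewrite !patchE; case: ifPn => // /set_mem; exact: fg.
Qed.

Lemma integral_itv_split (a b c : R) (f : R -> \bar R) :
  a <= b -> b <= c -> measurable_fun `[a, c] f ->
  (\int[mu]_(x in `[a, c]) f x =
     \int[mu]_(x in `[a, b]) f x + \int[mu]_(x in `[b, c]) f x)%E.
Proof.
move=> ab bc mf.
rewrite (@itv_bndbnd_setU _ _ _ (BRight b)) ?bnd_simp//.
rewrite integral_setU//=; last 2 first.
- by rewrite -itv_bndbnd_setU ?bnd_simp.
- apply/disj_setPS => y [/=]; rewrite 2!in_itv/= => /andP[_ yb] /andP[].
  by rewrite ltNge yb.
congr (_ + _)%E; rewrite integral_itv_obnd_cbnd//.
by apply: measurable_funS mf => //; apply: subset_itv; rewrite bnd_simp.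
Qed.

Lemma integral_unit_cells N (f : R -> \bar R) : (0 < N)%N ->
  measurable_fun (`[0, 1]%classic : set R) f ->
  (\int[mu]_(x in `[0%R, 1%R]) f x =
     \sum_(k < N) \int[mu]_(x in `[(k%:R / N%:R)%R, (k.+1%:R / N%:R)%R]) f x)%E.
Proof.
move=> N0 mf; have N0R : 0 < N%:R :> R by rewrite ltr0n.
suff H K : (K <= N)%N -> (\int[mu]_(x in `[0%R, (K%:R / N%:R)%R]) f x =
    \sum_(k < K) \int[mu]_(x in `[(k%:R / N%:R)%R, (k.+1%:R / N%:R)%R]) f x)%E.
  by rewrite -H// divff// gt_eqF.
elim: K => [_|K ih KN]; first by rewrite big_ord0 mul0r set_itv1 integral_set1.
rewrite big_ord_recr/= -ih ?(ltnW KN)//; apply: integral_itv_split.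
- by rewrite divr_ge0.
- by rewrite ler_pM2r ?invr_gt0// ler_nat.
- apply: measurable_funS mf => //; apply: subset_itv; rewrite bnd_simp//.
  by rewrite ler_pdivrMr// mul1r ler_nat.
Qed.

(** * Cells of the unit interval and the midpoint rule *)

Definition cellc N (k : nat) : R := (k%:R + 2^-1) / N%:R.

Definition midsum N (f : R -> R) : R := N%:R^-1 * \sum_(k < N) f (cellc N k).

Lemma cellc_itv N k : (k < N)%N -> 0 <= cellc N k <= 1.
Proof.
move=> kN; have N0R : 0 < N%:R :> R by rewrite ltr0n (leq_ltn_trans _ kN).
have k0 : 0 <= k%:R :> R by [].
rewrite /cellc divr_ge0//= ?addr_ge0 ?invr_ge0//.
rewrite ler_pdivrMr// mul1r.
have : k.+1%:R <= N%:R :> R by rewrite ler_nat.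
by rewrite -natr1; lra.
Qed.

Lemma cell_sub_unit N k (t : R) : (k < N)%N ->
  k%:R / N%:R <= t <= k.+1%:R / N%:R -> 0 <= t <= 1.
Proof.
move=> kN /andP[kt tk]; have N0R : 0 < N%:R :> R by rewrite ltr0n (leq_ltn_trans _ kN).
rewrite (le_trans _ kt) ?divr_ge0//= (le_trans tk)//.
by rewrite ler_pdivrMr// mul1r ler_nat.
Qed.

Lemma cell_dist N k (t : R) : (k < N)%N ->
  k%:R / N%:R <= t <= k.+1%:R / N%:R -> `|t - cellc N k| <= (2 * N%:R)^-1.
Proof.
move=> kN; have N0R : 0 < N%:R :> R by rewrite ltr0n (leq_ltn_trans _ kN).
rewrite /cellc ler_norml -natr1 invfM !mulrDl mul1r; set a := k%:R / _; set b := N%:R^-1.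
by move=> /andP[? ?]; apply/andP; split; lra.
Qed.

(** Only the open cells are constrained, because boundary points may be assigned to either neighbor.
    The covered interval grows cell by cell, and adding an endpoint preserves measurability. *)
Lemma measurable_fun_cells N (f : R -> \bar R) (v : nat -> \bar R) :
  (0 < N)%N ->
  (forall k t, (k < N)%N -> k%:R / N%:R < t < k.+1%:R / N%:R -> f t = v k) ->
  measurable_fun (`[0, 1]%classic : set R) f.
Proof.
move=> N0 fv; have N0R : 0 < N%:R :> R by rewrite ltr0n.
suff H K : (K <= N)%N -> measurable_fun (`[0, K%:R / N%:R]%classic : set R) f.
  by have := H N (leqnn _); rewrite divff// gt_eqF.
elim: K => [_|K ih KN].
  by rewrite mul0r set_itv1; exact: measurable_fun_set1.
rewrite (@itv_bndbnd_setU _ _ _ (BRight (K%:R / N%:R))); last 2 first.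
- by rewrite bnd_simp divr_ge0.
- by rewrite bnd_simp ler_pM2r ?invr_gt0// ler_nat.
apply/measurable_funU => //; split; first by apply: ih; exact: ltnW.
apply/emeasurable_fun_itv_bndo_bndcP.
apply: (eq_measurable_fun (cst (v K))) => //.
by move=> t /set_mem /=; rewrite in_itv/= => /(fv K t KN) ->.
Qed.

Lemma integral_cells_step N (f : R -> \bar R) (v : nat -> R) :
  (0 < N)%N ->
  (forall k t, (k < N)%N -> k%:R / N%:R < t < k.+1%:R / N%:R -> f t = (v k)%:E) ->
  (\int[mu]_(x in `[0%R, 1%R]) f x = (N%:R^-1 * \sum_(k < N) v k)%:E)%E.
Proof.
move=> N0 fv; have N0R : 0 < N%:R :> R by rewrite ltr0n.
rewrite (integral_unit_cells N0); last exact: (measurable_fun_cells N0 fv).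
rewrite mulr_sumr -sumEFin; apply: eq_bigr => k _.
have mk : measurable_fun (`]k%:R / N%:R, k.+1%:R / N%:R[%classic : set R) f.
  apply: (eq_measurable_fun (cst (v k)%:E)) => //.
  by move=> t /set_mem /=; rewrite in_itv/= => /(fv k t (ltn_ord k)) ->.
rewrite (integral_itv_bndoo true false mk).
rewrite (eq_integral (cst (v k)%:E)); last first.
  by move=> t /set_mem /=; rewrite in_itv/= => /(fv k t (ltn_ord k)) ->.
rewrite integral_cst//= lebesgue_measure_itv/= lte_fin.
rewrite ltr_pM2r ?invr_gt0// ltr_nat ltnSn -EFinB -EFinM; congr (_%:E).
by rewrite -mulrBl -natr1 addrAC subrr add0r mul1r mulrC.
Qed.

Lemma continuous_ftc F (dF : R -> R) a b : a < b ->
  (forall x : R, is_derive x (1 : R) F (dF x)) -> continuous dF ->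
  (\int[mu]_(x in `[a, b]) (dF x)%:E = (F b - F a)%:E)%E.
Proof.
move=> ab dFF cdF; rewrite (@continuous_FTC2 _ dF F)//.
- exact: continuous_subspaceT.
- have cF x : {for x, continuous F}.
    by apply/differentiable_continuous/derivable1_diffP; have [] := dFF x.
  split.
  + by move=> x _; have [] := dFF x.
  + by apply: cvg_at_right_filter; exact: cF.
  + by apply: cvg_at_left_filter; exact: cF.
- by move=> x _; rewrite derive1E; have [] := dFF x.
Qed.

Lemma integral_le_ftc F (dF : R -> R) f a b : a < b ->
  (forall x : R, is_derive x (1 : R) F (dF x)) -> continuous dF ->
  {within `[a, b], continuous f} ->
  (forall x, a <= x <= b -> f x <= dF x) ->
  (\int[mu]_(x in `[a, b]) (f x)%:E <= (F b - F a)%:E)%E.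
Proof.
move=> ab dFF cdF cf fdF; rewrite -(continuous_ftc ab dFF cdF).
apply: le_integral => //.
- by apply: continuous_compact_integrable => //; exact: segment_compact.
- apply: continuous_compact_integrable; first exact: segment_compact.
  exact: continuous_subspaceT.
- by move=> x /set_mem /=; rewrite in_itv/= lee_fin; exact: fdF.
Qed.

Lemma integral_ge_ftc F (dF : R -> R) f a b : a < b ->
  (forall x : R, is_derive x (1 : R) F (dF x)) -> continuous dF ->
  {within `[a, b], continuous f} ->
  (forall x, a <= x <= b -> dF x <= f x) ->
  ((F b - F a)%:E <= \int[mu]_(x in `[a, b]) (f x)%:E)%E.
Proof.
move=> ab dFF cdF cf fdF; rewrite -(continuous_ftc ab dFF cdF).
apply: le_integral => //.
- apply: continuous_compact_integrable; first exact: segment_compact.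
  exact: continuous_subspaceT.
- by apply: continuous_compact_integrable => //; exact: segment_compact.
- by move=> x /set_mem /=; rewrite in_itv/= lee_fin; exact: fdF.
Qed.

Lemma is_derive_primitive_quadratic (A0 A1 A2 c x : R) :
  is_derive x (1 : R)
    (fun t => A0 * (t - c) + A1 / 2 * (t - c) ^+ 2 + A2 / 3 * (t - c) ^+ 3)
    (A0 + A1 * (x - c) + A2 * (x - c) ^+ 2).
Proof.
apply: is_derive_eq.
by rewrite /GRing.scale/= subr0; field.
Qed.

Lemma quadratic_continuous (A0 A1 A2 c : R) :
  continuous (fun x : R => A0 + A1 * (x - c) + A2 * (x - c) ^+ 2).
Proof.
move=> x; apply/differentiable_continuous/derivable1_diffP.
have [] // : is_derive x (1 : R) (fun t : R => A0 + A1 * (t - c) + A2 * (t - c) ^+ 2)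
  (A1 + 2 * A2 * (x - c)).
by apply: is_derive_eq; rewrite /GRing.scale/= subr0; ring.
Qed.

End UnitInterval.

(** * One-dimensional midpoint estimates *)

Section Sandwich.
Variable R : realType.
Notation mu := (@lebesgue_measure R).
Implicit Types (f g : R -> R) (N : nat) (B e : R).

Lemma within_continuous_sub_unit f (a b : R) : 0 <= a -> b <= 1 ->
  {within `[0, 1], continuous f} -> {within `[a, b], continuous f}.
Proof.
move=> a0 b1; apply: continuous_subspaceW.
by apply: subset_itv; rewrite bnd_simp.
Qed.

(** Centering at the midpoint cancels the linear term, and the square of the distance to the center
    has mean 1/(12 N^2) over a cell of width 1/N. *)
Lemma primitive_quadratic_cell N k (A0 A1 A2 : R) : (k < N)%N ->
  let F t := A0 * (t - cellc R N k) + A1 / 2 * (t - cellc R N k) ^+ 2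
             + A2 / 3 * (t - cellc R N k) ^+ 3 in
  F (k.+1%:R / N%:R) - F (k%:R / N%:R) =
  N%:R^-1 * (A0 + A2 / (12 * N%:R ^+ 2)).
Proof.
move=> kN; have N0R : N%:R != 0 :> R by rewrite pnatr_eq0; case: N kN.
by rewrite /cellc /= -natr1; field; rewrite N0R.
Qed.

Lemma cell_ltS N k : (k < N)%N -> k%:R / N%:R < k.+1%:R / N%:R :> R.
Proof.
move=> kN; rewrite ltr_pM2r ?ltr_nat// invr_gt0 ltr0n.
exact: leq_ltn_trans kN.
Qed.

Lemma cell_bounds N k : (k < N)%N ->
  0 <= k%:R / N%:R :> R /\ k.+1%:R / N%:R <= 1 :> R.
Proof.
move=> kN; have N0R : 0 < N%:R :> R by rewrite ltr0n (leq_ltn_trans _ kN).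
by rewrite divr_ge0// ler_pdivrMr// mul1r ler_nat.
Qed.

Lemma measurable_within_continuous f :
  {within `[0, 1], continuous f} -> measurable_fun (`[0, 1]%classic : set R) f.
Proof.
by move=> cf; apply: subspace_continuous_measurable_fun.
Qed.

(** The slopes [A1] are free and leave no trace in the bound: this is the source of the second-order
    accuracy. *)
Lemma integral_le_quadratic N f (A0 A1 A2 : nat -> R) : (0 < N)%N ->
  {within `[0, 1], continuous f} ->
  (forall k t, (k < N)%N -> k%:R / N%:R <= t <= k.+1%:R / N%:R ->
    f t <= A0 k + A1 k * (t - cellc R N k) + A2 k * (t - cellc R N k) ^+ 2) ->
  (\int[mu]_(t in `[0%R, 1%R]) (f t)%:E <=
   (N%:R^-1 * \sum_(k < N) (A0 k + A2 k / (12 * N%:R ^+ 2)))%:E)%E.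
Proof.
move=> N0 cf fq.
rewrite (integral_unit_cells N0); last first.
  by apply/measurable_EFinP; exact: measurable_within_continuous.
rewrite mulr_sumr -sumEFin; apply: lee_sum => k _.
have kN := ltn_ord k; have [k0 k1] := cell_bounds kN.
rewrite -(primitive_quadratic_cell (A0 k) (A1 k) (A2 k) kN).
apply: (@integral_le_ftc _ _ _ _ _ _ (cell_ltS kN)
  (is_derive_primitive_quadratic (A0 k) (A1 k) (A2 k) (cellc R N k))).
- exact: quadratic_continuous.
- exact: within_continuous_sub_unit cf.
- by move=> t; exact: fq.
Qed.

Lemma integral_ge_quadratic N f (A0 A1 A2 : nat -> R) : (0 < N)%N ->
  {within `[0, 1], continuous f} ->
  (forall k t, (k < N)%N -> k%:R / N%:R <= t <= k.+1%:R / N%:R ->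
    A0 k + A1 k * (t - cellc R N k) + A2 k * (t - cellc R N k) ^+ 2 <= f t) ->
  ((N%:R^-1 * \sum_(k < N) (A0 k + A2 k / (12 * N%:R ^+ 2)))%:E <=
   \int[mu]_(t in `[0%R, 1%R]) (f t)%:E)%E.
Proof.
move=> N0 cf fq.
rewrite (integral_unit_cells N0); last first.
  by apply/measurable_EFinP; exact: measurable_within_continuous.
rewrite mulr_sumr -sumEFin; apply: lee_sum => k _.
have kN := ltn_ord k; have [k0 k1] := cell_bounds kN.
rewrite -(primitive_quadratic_cell (A0 k) (A1 k) (A2 k) kN).
apply: (@integral_ge_ftc _ _ _ _ _ _ (cell_ltS kN)
  (is_derive_primitive_quadratic (A0 k) (A1 k) (A2 k) (cellc R N k))).
- exact: quadratic_continuous.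
- exact: within_continuous_sub_unit cf.
- by move=> t; exact: fq.
Qed.

(** The error is multiplicative, so that the errors of successive coordinates add up in the
    exponent. Measurability and nonnegativity are included so that the property passes to sums and
    nonnegative multiples, hence to midpoint sums over the other coordinates. *)
Definition sandwich N e f :=
  [/\ measurable_fun (`[0, 1]%classic : set R) f,
      forall t, 0 <= t <= 1 -> 0 <= f t,
      ((expR (- e) * midsum N f)%:E <=
         \int[mu]_(t in `[0%R, 1%R]) (f t)%:E)%E &
      (\int[mu]_(t in `[0%R, 1%R]) (f t)%:E <= (expR e * midsum N f)%:E)%E].

Lemma eq_sandwich N e f g : f =1 g -> sandwich N e f -> sandwich N e g.
Proof. by move=> /funext ->. Qed.

Lemma sandwich0 N e : sandwich N e (fun=> 0).
Proof.
rewrite /sandwich /midsum big1 ?mulr0//.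
by rewrite integral0_eq//; split.
Qed.

Lemma sandwichD N e f g :
  sandwich N e f -> sandwich N e g -> sandwich N e (fun t => f t + g t).
Proof.
move=> [mf f0 lf uf] [mg g0 lg ug].
have E : (\int[mu]_(t in `[0%R, 1%R]) (f t + g t)%:E =
   \int[mu]_(t in `[0%R, 1%R]) (f t)%:E + \int[mu]_(t in `[0%R, 1%R]) (g t)%:E)%E.
  under eq_integral do rewrite EFinD.
  have f0' t : (`[0, 1]%classic : set R) t -> (0 <= (f t)%:E)%E.
    by rewrite /= in_itv/= lee_fin => /f0.
  have g0' t : (`[0, 1]%classic : set R) t -> (0 <= (g t)%:E)%E.
    by rewrite /= in_itv/= lee_fin => /g0.
  by rewrite ge0_integralD//; exact/measurable_EFinP.
have M : midsum N (fun t => f t + g t) = midsum N f + midsum N g.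
  by rewrite /midsum big_split mulrDr.
split.
- exact: measurable_funD.
- by move=> t t01; rewrite addr_ge0 ?f0 ?g0.
- by rewrite E M mulrDr EFinD leeD.
- by rewrite E M mulrDr EFinD leeD.
Qed.

Lemma sandwichZ N e f (a : R) : 0 <= a ->
  sandwich N e f -> sandwich N e (fun t => a * f t).
Proof.
move=> a0 [mf f0 lf uf].
have E : (\int[mu]_(t in `[0%R, 1%R]) (a * f t)%:E =
   a%:E * \int[mu]_(t in `[0%R, 1%R]) (f t)%:E)%E.
  under eq_integral do rewrite EFinM.
  have f0' t : (`[0, 1]%classic : set R) t -> (0 <= (f t)%:E)%E.
    by rewrite /= in_itv/= lee_fin => /f0.
  by rewrite ge0_integralZl//; exact/measurable_EFinP.
have M : midsum N (fun t => a * f t) = a * midsum N f.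
  by rewrite /midsum -mulr_sumr mulrCA.
split.
- by apply: measurable_funM => //; exact: measurable_cst.
- by move=> t t01; rewrite mulr_ge0 ?f0.
- by rewrite E M mulrCA EFinM; apply: lee_wpmul2l => //; rewrite lee_fin.
- by rewrite E M mulrCA EFinM; apply: lee_wpmul2l => //; rewrite lee_fin.
Qed.

Lemma sandwich_sum N e (I : Type) (s : seq I) (F : I -> R -> R) :
  (forall i, sandwich N e (F i)) -> sandwich N e (fun t => \sum_(i <- s) F i t).
Proof.
move=> sF; elim: s => [|i s ih].
  by apply: eq_sandwich (sandwich0 N e) => t; rewrite big_nil.
by apply: eq_sandwich (sandwichD (sF i) ih) => t; rewrite big_cons.
Qed.

(** * First- and second-order sandwich bounds for exponentials *)

Definition lipschitz01 B f := forall s t, 0 <= s <= 1 -> 0 <= t <= 1 ->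
  `|f s - f t| <= B * `|s - t|.

Lemma lipschitz01_continuous B f : 0 < B -> lipschitz01 B f ->
  {within `[0, 1], continuous f}.
Proof.
move=> B0 lf; apply/subspace_continuousP => x /=; rewrite in_itv/= => x01.
apply/cvgrPdist_lt => e e0; rewrite near_withinE.
apply/nbhs_ballP; exists (e / B) => /=; first by rewrite divr_gt0.
move=> t /=; rewrite /ball/= => xt; rewrite in_itv/= => t01.
apply: le_lt_trans (lf _ _ x01 t01) _.
by rewrite mulrC -ltr_pdivlMr.
Qed.

Lemma lipschitz01_exp_continuous B f : 0 < B -> lipschitz01 B f ->
  {within `[0, 1], continuous (expR \o f)}.
Proof.
move=> B0 lf; apply/subspace_continuousP => x x01.
have /subspace_continuousP/(_ x x01) fx := lipschitz01_continuous B0 lf.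
by apply: continuous_cvg fx; exact: continuous_expR.
Qed.

(** On a cell, [f] stays within [B] times the half-width of its central value, so constants, that
    is, quadratics with [A1 = A2 = 0], bound the exponential on both sides. *)
Lemma sandwich_lipschitz N B f : (0 < N)%N -> 0 < B -> lipschitz01 B f ->
  sandwich N (B / (2 * N%:R)) (expR \o f).
Proof.
move=> N0 B0 lf; have N0R : 0 < N%:R :> R by rewrite ltr0n.
have cf := lipschitz01_exp_continuous B0 lf.
have cell k t : (k < N)%N -> k%:R / N%:R <= t <= k.+1%:R / N%:R ->
    `|f t - f (cellc R N k)| <= B / (2 * N%:R).
  move=> kN kt.
  apply: le_trans (lf t (cellc R N k) (cell_sub_unit kN kt) (cellc_itv R kN)) _.
  by rewrite ler_wpM2l ?(ltW B0)// cell_dist.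
split.
- exact: measurable_within_continuous.
- by move=> t _; exact: expR_ge0.
- pose A0 k := expR (- (B / (2 * N%:R))) * expR (f (cellc R N k)).
  have := @integral_ge_quadratic N (expR \o f) A0 (fun=> 0) (fun=> 0) N0 cf.
  under eq_bigr do rewrite mul0r addr0.
  rewrite /midsum mulrCA -mulr_sumr; apply => k t kN kt.
  rewrite !mul0r !addr0 /A0 -expRD ler_expR.
  by have := cell k t kN kt; rewrite ler_norml => /andP[? ?]; lra.
- pose A0 k := expR (B / (2 * N%:R)) * expR (f (cellc R N k)).
  have := @integral_le_quadratic N (expR \o f) A0 (fun=> 0) (fun=> 0) N0 cf.
  under eq_bigr do rewrite mul0r addr0.
  rewrite /midsum mulrCA -mulr_sumr; apply => k t kN kt.
  rewrite !mul0r !addr0 /A0 -expRD ler_expR.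
  by have := cell k t kN kt; rewrite ler_norml => /andP[? ?]; lra.
Qed.

(** Invert [1 - y <= expR (- y)]: the product of [1 - y] with the right-hand side is
    [1 + y ^+ 2 * (1 - 2 * y)], at least 1 in the given range. *)
Lemma expR_le_quadratic (y : R) : y <= 2^-1 -> expR y <= 1 + y + 2 * y ^+ 2.
Proof.
move=> y2; have := expR_ge1Dx (- y).
rewrite expRN => h; have y1 : 0 < 1 - y by lra.
rewrite -(ler_pM2l y1); apply: (@le_trans _ _ 1).
  by rewrite -ler_pdivlMr ?expR_gt0// mul1r; lra.
rewrite -subr_ge0.
have -> : (1 - y) * (1 + y + 2 * y ^+ 2) - 1 = y ^+ 2 * (1 - 2 * y) by ring.
by rewrite mulr_ge0 ?sqr_ge0//; lra.
Qed.

(** Square [1 + y / 2 <= expR (y / 2)], whose left side is nonnegative in the given range. *)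
Lemma expR_ge_quadratic (y : R) : - 2 <= y -> 1 + y + y ^+ 2 / 4 <= expR y.
Proof.
move=> y2; have -> : y = y / 2 + y / 2 by field.
rewrite expRD; have := expR_ge1Dx (y / 2); set E := expR _ => hE.
have -> : 1 + (y / 2 + y / 2) + (y / 2 + y / 2) ^+ 2 / 4 = (1 + y / 2) * (1 + y / 2).
  by field.
by apply: ler_pM => //; lra.
Qed.

(** The slope [a] is existential because [c] may be an endpoint, where the derivative exists only as
    a continuous extension. The constant [B], without a factor 1/2, is what two mean value steps
    give. *)
Definition taylor01 B f := forall c, 0 <= c <= 1 ->
  exists2 a, `|a| <= B & forall s, 0 <= s <= 1 ->
    `|f s - f c - a * (s - c)| <= B * (s - c) ^+ 2.

(** The linear Taylor term averages out on each cell. The remainder costs B/(4 N^2) in the exponent;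
    from above, the quadratic bound on the exponential costs a further B^2/(6 N^2). *)
Lemma sandwich_taylor N B f : (0 < N)%N -> 0 < B -> lipschitz01 B f ->
  taylor01 B f -> B / N%:R <= 1 ->
  sandwich N (Num.max B (B ^+ 2) / N%:R ^+ 2) (expR \o f).
Proof.
move=> N0 B0 lf tf BN; have N0R : 0 < N%:R :> R by rewrite ltr0n.
have cf := lipschitz01_exp_continuous B0 lf.
(* Slopes are chosen for all [k] at once; [0] is a dummy value for [k >= N]. *)
have /choice[a Ha] : forall k : nat, exists a, (k < N)%N ->
    `|a| <= B /\ forall s, 0 <= s <= 1 ->
    `|f s - f (cellc R N k) - a * (s - cellc R N k)| <= B * (s - cellc R N k) ^+ 2.
  move=> k; have [kN|//] := boolP (k < N)%N; last by exists 0.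
  by have [a ? ?] := tf _ (cellc_itv R kN); exists a.
pose w : R := (2 * N%:R)^-1.
have w0 : 0 < w by rewrite invr_gt0 mulr_gt0.
have wE : w = N%:R^-1 / 2 by rewrite /w invfM mulrC.
have sq k t : (k < N)%N -> k%:R / N%:R <= t <= k.+1%:R / N%:R ->
    (t - cellc R N k) ^+ 2 <= w ^+ 2.
  move=> kN kt; rewrite -real_normK ?num_real//.
  by rewrite ler_sqr ?nnegrE ?(ltW w0)// cell_dist.
have tay k t : (k < N)%N -> k%:R / N%:R <= t <= k.+1%:R / N%:R ->
    `|f t - f (cellc R N k) - a k * (t - cellc R N k)| <= B * w ^+ 2.
  move=> kN kt; have [_ /(_ t (cell_sub_unit kN kt)) h] := Ha k kN.
  by apply: le_trans h _; rewrite ler_wpM2l ?(ltW B0)// sq.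
have wsq : w ^+ 2 = (N%:R ^+ 2)^-1 / 4.
  by rewrite wE; field; rewrite gt_eqF.
have invN0 : 0 < (N%:R ^+ 2)^-1 :> R by rewrite invr_gt0 exprn_gt0.
have maxB : B <= Num.max B (B ^+ 2) by rewrite le_max lexx.
have maxB2 : B ^+ 2 <= Num.max B (B ^+ 2) by rewrite le_max lexx orbT.
set M := Num.max B (B ^+ 2) in maxB maxB2 *.
split.
- exact: measurable_within_continuous.
- by move=> t _; exact: expR_ge0.
(* The Taylor remainder goes into the coefficient [A0]; what is left is the tangent-line bound for
   the exponential. *)
- pose A0 k := expR (- (B * w ^+ 2)) * expR (f (cellc R N k)).
  have := @integral_ge_quadratic N (expR \o f) A0 (fun k => A0 k * a k) (fun=> 0) N0 cf.
  under eq_bigr do rewrite mul0r addr0.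
  move=> H; apply: le_trans (H _) => {H}; last first.
    move=> k t kN kt; rewrite mul0r addr0 -mulrA -[X in X + _]mulr1 -mulrDr.
    apply: (@le_trans _ _ (A0 k * expR (a k * (t - cellc R N k)))).
      by rewrite ler_wpM2l ?expR_ge1Dx// mulr_ge0 ?expR_ge0.
    rewrite /A0 -!expRD ler_expR.
    by have := tay k t kN kt; rewrite ler_norml => /andP[? ?]; lra.
  rewrite lee_fin /midsum -mulr_sumr [leRHS]mulrCA ler_wpM2r//.
    by rewrite mulr_ge0 ?invr_ge0// sumr_ge0// => k _; exact: expR_ge0.
  rewrite ler_expR lerN2 wsq mulrA -mulrA mulrC.
  have : B * (N%:R ^+ 2)^-1 <= M * (N%:R ^+ 2)^-1 by rewrite ler_pM2r.
  have : 0 <= B * (N%:R ^+ 2)^-1 by rewrite mulr_ge0// ltW.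
  by lra.
- pose A0 k := expR (B * w ^+ 2) * expR (f (cellc R N k)).
  have := @integral_le_quadratic N (expR \o f) A0 (fun k => A0 k * a k)
    (fun k => A0 k * (2 * B ^+ 2)) N0 cf.
  under eq_bigr do rewrite -mulrA -[X in X + _]mulr1 -mulrDr.
  move=> H; apply: le_trans (H _) _ => {H}.
    move=> k t kN kt; set h := t - _.
    have [aB _] := Ha k kN.
    have hw : `|h| <= w by exact: cell_dist.
    (* Here [B / N%:R <= 1] brings the linear term into the range of [expR_le_quadratic]. *)
    have ah : `|a k * h| <= 2^-1.
      rewrite normrM; apply: le_trans (ler_pM _ _ aB hw) _ => //.
      by rewrite wE mulrA -[leRHS]mul1r ler_pM2r.
    apply: (@le_trans _ _ (A0 k * expR (a k * h))).
      rewrite /A0 -!expRD ler_expR.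
      by have := tay k t kN kt; rewrite ler_norml -/h => /andP[? ?]; lra.
    have A00 : 0 <= A0 k by rewrite mulr_ge0 ?expR_ge0.
    have -> : A0 k + A0 k * a k * h + A0 k * (2 * B ^+ 2) * h ^+ 2 =
              A0 k * (1 + a k * h + 2 * (B ^+ 2 * h ^+ 2)) by ring.
    rewrite ler_wpM2l//.
    apply: le_trans (expR_le_quadratic _) _.
      by move: ah; rewrite ler_norml => /andP[].
    rewrite lerD2l ler_pM2l// exprMn ler_wpM2r ?sqr_ge0//.
    by rewrite -real_normK ?num_real// ler_sqr ?nnegrE ?(ltW B0).
  rewrite -mulr_suml -mulr_sumr /midsum lee_fin.
  set Q := \sum_(_ < _) _.
  have Q0 : 0 <= N%:R^-1 * Q.
    by rewrite mulr_ge0 ?invr_ge0// sumr_ge0// => k _; exact: expR_ge0.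
  (* The averaged quadratic correction becomes an exponential factor through [expR_ge1Dx]. *)
  apply: (@le_trans _ _ (expR (B * w ^+ 2) * expR (2 * B ^+ 2 / (12 * N%:R ^+ 2)) * (N%:R^-1 * Q))).
    rewrite mulrA [X in X * _ <= _]mulrCA -[leLHS]mulrA -[leRHS]mulrA.
    rewrite ler_wpM2l ?expR_ge0// mulrC ler_wpM2r//.
    exact: expR_ge1Dx.
  rewrite ler_wpM2r// -expRD ler_expR wsq [(12 * _)^-1]invfM.
  have : B * (N%:R ^+ 2)^-1 <= M * (N%:R ^+ 2)^-1 by rewrite ler_pM2r.
  have : B ^+ 2 * (N%:R ^+ 2)^-1 <= M * (N%:R ^+ 2)^-1 by rewrite ler_pM2r.
  have : 0 <= M * (N%:R ^+ 2)^-1.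
    by rewrite mulr_ge0 ?ltW//; exact: lt_le_trans B0 maxB.
  by move: (N%:R ^+ 2)^-1 => i; move: (B ^+ 2) => b; nra.
Qed.

End Sandwich.

(** * Iterated integrals over the cube *)

Section Cube.
Variable R : realType.
Notation mu := (@lebesgue_measure R).
Implicit Types (d N : nat) (B e : R).

(** Spelled exactly as in [cint], so that unfolding one integral is definitional. *)
Definition consv d (t : R) (y : 'rV[R]_d) : 'rV[R]_d.+1 :=
  row_mx (const_mx t : 'rV[R]_1) y.

Lemma consv0 d t (y : 'rV[R]_d) : consv t y ord0 ord0 = t.
Proof.
transitivity ((const_mx t : 'rV[R]_1) ord0 ord0); last by rewrite mxE.
rewrite -(row_mxEl (const_mx t : 'rV[R]_1) y ord0 ord0).
by congr (fun_of_matrix _ _ _); exact/val_inj.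
Qed.

Lemma consvS d t (y : 'rV[R]_d) j : consv t y ord0 (lift ord0 j) = y ord0 j.
Proof.
rewrite -(row_mxEr (const_mx t : 'rV[R]_1) y ord0 j).
by congr (fun_of_matrix _ _ _); exact/val_inj.
Qed.

Lemma eq_consv d (x : 'rV[R]_d.+1) t (y : 'rV[R]_d) :
  x ord0 ord0 = t -> (forall j, x ord0 (lift ord0 j) = y ord0 j) -> x = consv t y.
Proof.
move=> x0 xS; apply/rowP => i; case: (unliftP ord0 i) => [j ->|->].
  by rewrite xS consvS.
by rewrite x0 consv0.
Qed.

Lemma consv_surj d (x : 'rV[R]_d.+1) :
  x = consv (x ord0 ord0) (\row_j x ord0 (lift ord0 j)).
Proof. by apply: eq_consv => // j; rewrite mxE. Qed.

Lemma cubeX_consv d t (y : 'rV[R]_d) :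
  cubeX (consv t y) <-> (0 <= t <= 1 /\ cubeX y).
Proof.
split=> [H|[t01 Hy] i].
  by split=> [|j]; [have := H ord0|have := H (lift ord0 j)]; rewrite ?consv0 ?consvS.
by case: (unliftP ord0 i) => [j ->|->]; rewrite ?consv0 ?consvS.
Qed.

Lemma cintS d (h : 'rV[R]_d.+1 -> \bar R) :
  cint h = (\int[mu]_(t in `[0%R, 1%R]) cint (fun y => h (consv t y)))%E.
Proof. by []. Qed.

Lemma cint_ge0 d (h : 'rV[R]_d -> \bar R) :
  (forall x, cubeX x -> (0 <= h x)%E) -> (0 <= cint h)%E.
Proof.
elim: d h => [h h0|d ih h h0]; first by apply: h0 => -[].
rewrite cintS; apply: integral_ge0 => t /=; rewrite in_itv/= => t01.
by apply: ih => y y01; apply: h0; exact/cubeX_consv.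
Qed.

Lemma cint_le d (h g : 'rV[R]_d -> \bar R) :
  (forall x, cubeX x -> (0 <= h x)%E) -> (forall x, cubeX x -> (h x <= g x)%E) ->
  (cint h <= cint g)%E.
Proof.
elim: d h g => [h g h0 hg|d ih h g h0 hg]; first by apply: hg => -[].
rewrite !cintS; apply: le_integral_nonmeasurable => t /=; rewrite in_itv/= => t01.
  by apply: cint_ge0 => y y01; apply: h0; exact/cubeX_consv.
by apply: ih => y y01; [apply: h0|apply: hg]; exact/cubeX_consv.
Qed.

Lemma eq_cint d (h g : 'rV[R]_d -> \bar R) :
  (forall x, cubeX x -> h x = g x) -> cint h = cint g.
Proof.
elim: d h g => [h g hg|d ih h g hg]; first by apply: hg => -[].
rewrite !cintS; apply: eq_integral => t /set_mem /=; rewrite in_itv/= => t01.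
by apply: ih => y y01; apply: hg; exact/cubeX_consv.
Qed.

Lemma cint_cst d (c : R) : cint (fun _ : 'rV[R]_d => c%:E) = c%:E.
Proof.
elim: d => [//|d ih]; rewrite cintS.
under eq_integral do rewrite ih.
by rewrite integral_cst//= lebesgue_measure_itv/= lte_fin ltr01 sube0 mule1.
Qed.

Lemma cint_first d (h : R -> R) :
  cint (fun x : 'rV[R]_d.+1 => (h (x ord0 ord0))%:E) =
  (\int[mu]_(t in `[0%R, 1%R]) (h t)%:E)%E.
Proof.
rewrite cintS; apply: eq_integral => t _.
rewrite -[RHS](cint_cst d); congr cint; apply/funext => y.
by rewrite consv0.
Qed.

(** The recursion mirrors that of [cint], with [midsum] for the integral, so that the two can be
    compared one coordinate at a time. *)
Fixpoint csum N d : ('rV[R]_d -> R) -> R :=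
  match d return ('rV[R]_d -> R) -> R with
  | 0 => fun h => h 0
  | S d' => fun h => midsum N (fun t => csum N (fun y : 'rV[R]_d' => h (consv t y)))
  end.

Lemma eq_midsum N (f g : R -> R) :
  (forall k, (k < N)%N -> f (cellc R N k) = g (cellc R N k)) ->
  midsum N f = midsum N g.
Proof. by move=> fg; congr (_ * _); apply: eq_bigr => k _; exact: fg. Qed.

Lemma midsum_cst N (c : R) : (0 < N)%N -> midsum N (fun=> c) = c.
Proof.
move=> N0; rewrite /midsum sumr_const card_ord -[c *+ N]mulr_natl mulrA mulVf ?mul1r//.
by rewrite pnatr_eq0 -lt0n.
Qed.

Lemma midsum_gt0 N (f : R -> R) : (0 < N)%N ->
  (forall k, (k < N)%N -> 0 < f (cellc R N k)) -> 0 < midsum N f.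
Proof.
move=> N0 f0; rewrite mulr_gt0 ?invr_gt0 ?ltr0n//.
case: N N0 f0 => // N _ f0; rewrite big_ord_recl/= ltr_pwDl ?f0//.
by rewrite sumr_ge0// => k _; rewrite ltW// f0//= ltnS.
Qed.

Lemma csum_gt0 N d (h : 'rV[R]_d -> R) : (0 < N)%N ->
  (forall x, 0 < h x) -> 0 < csum N h.
Proof.
move=> N0; elim: d h => [h h0|d ih h h0] /=; first exact: h0.
by apply: midsum_gt0 => // k _; apply: ih.
Qed.

Lemma csum_cst N d (c : R) : (0 < N)%N -> csum N (fun _ : 'rV[R]_d => c) = c.
Proof.
move=> N0; elim: d => [//|d ih] /=.
by rewrite -[RHS](midsum_cst c N0); apply: eq_midsum.
Qed.

Lemma csum_first N d (h : R -> R) : (0 < N)%N ->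
  csum N (fun x : 'rV[R]_d.+1 => h (x ord0 ord0)) = midsum N h.
Proof.
move=> N0 /=; apply: eq_midsum => k _.
rewrite -[RHS](csum_cst d _ N0); congr csum; apply/funext => y.
by rewrite consv0.
Qed.

Lemma csum_sandwich N e d (F : R -> 'rV[R]_d -> R) :
  (forall y, cubeX y -> sandwich N e (fun t => F t y)) ->
  sandwich N e (fun t => csum N (F t)).
Proof.
elim: d F => [F HF|d ih F HF] /=; first by apply: HF => -[].
apply: sandwichZ; first by rewrite invr_ge0.
apply: sandwich_sum => k; apply: ih => y y01; apply: HF; apply/cubeX_consv.
by split => //; exact: cellc_itv.
Qed.

Definition upd d (x : 'rV[R]_d) (j : 'I_d) (s : R) : 'rV[R]_d :=
  \row_i (if i == j then s else x ord0 i).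

Lemma updE d (x : 'rV[R]_d) j s i :
  upd x j s ord0 i = if i == j then s else x ord0 i.
Proof. by rewrite mxE. Qed.

Lemma upd_consv0 d t (y : 'rV[R]_d) s : upd (consv t y) ord0 s = consv s y.
Proof.
by apply: eq_consv => [|j]; rewrite updE ?eqxx// eq_sym eq_liftF consvS.
Qed.

Lemma upd_consvS d t (y : 'rV[R]_d) j s :
  upd (consv t y) (lift ord0 j) s = consv t (upd y j s).
Proof.
apply: eq_consv => [|i]; first by rewrite updE eq_liftF consv0.
by rewrite !updE (inj_eq lift_inj) consvS.
Qed.

(** The upper bounds use [f] only through its restrictions to coordinate lines. The property passes
    to slices, which drives the inductions on [d]. *)
Definition lines d (P : (R -> R) -> Prop) (f : 'rV[R]_d -> R) :=
  forall x, cubeX x -> forall j, P (fun s => f (upd x j s)).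

Lemma lines_head d P (f : 'rV[R]_d.+1 -> R) : lines P f ->
  forall y, cubeX y -> P (fun s => f (consv s y)).
Proof.
move=> lf y y01; have : cubeX (consv 0 y) by apply/cubeX_consv; rewrite lexx ler01.
move=> /lf/(_ ord0); congr P; apply/funext => s; by rewrite upd_consv0.
Qed.

Lemma lines_slice d P (f : 'rV[R]_d.+1 -> R) : lines P f ->
  forall t, 0 <= t <= 1 -> lines P (fun y => f (consv t y)).
Proof.
move=> lf t t01 y y01 j; have : cubeX (consv t y) by exact/cubeX_consv.
move=> /lf/(_ (lift ord0 j)); congr P; apply/funext => s; by rewrite upd_consvS.
Qed.

(** By induction the inner integral at [t] is within a factor [expR (d%:R * e)] of the midpoint sum
    [G t], and [G], a nonnegative combination of sandwiched functions, costs one more [e].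
    Monotonicity of the outer integral needs no measurability of the slices. *)
Lemma cint_sandwich N e d (f : 'rV[R]_d -> R) :
  lines (fun phi => sandwich N e (expR \o phi)) f ->
  ((expR (- (d%:R * e)) * csum N (expR \o f))%:E <=
     cint (fun x => (expR (f x))%:E))%E /\
  (cint (fun x => (expR (f x))%:E) <=
     (expR (d%:R * e) * csum N (expR \o f))%:E)%E.
Proof.
elim: d f => [f _|d ih f lf]; first by rewrite /= mul0r oppr0 expR0 !mul1r.
pose G t := csum N (fun y => expR (f (consv t y))).
have sG : sandwich N e G.
  apply: (@csum_sandwich N e d (fun t y => expR (f (consv t y)))) => y y01.
  exact: lines_head lf y y01.
have ihS t : 0 <= t <= 1 -> _ := fun t01 => ih _ (lines_slice lf t01).
have [_ _ lZ _] := sandwichZ (expR_ge0 (- (d%:R * e))) sG.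
have [_ _ _ uZ] := sandwichZ (expR_ge0 (d%:R * e)) sG.
have [_ G0 _ _] := sG.
have mZ a : midsum N (fun t => a * G t) = a * midsum N G.
  by rewrite /midsum -mulr_sumr mulrCA.
have dS : d.+1%:R * e = e + d%:R * e by rewrite -natr1 mulrDl mul1r addrC.
rewrite cintS; split.
  apply: le_trans (le_trans lZ _).
    by rewrite mZ mulrA -expRD -opprD -dS.
  apply: le_integral_nonmeasurable => t /=; rewrite in_itv/= => t01.
    by rewrite lee_fin mulr_ge0 ?expR_ge0 ?G0.
  by have [] := ihS t t01.
apply: le_trans (le_trans _ uZ) _; last first.
  by rewrite mZ mulrA -expRD -dS.
apply: le_integral_nonmeasurable => t /=; rewrite in_itv/= => t01.
  by apply: cint_ge0 => y _; rewrite lee_fin expR_ge0.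
by have [] := ihS t t01.
Qed.

(** * The integrals [Zf f] and [Zf (gn asg f)], and the resulting upper bounds *)

Lemma valid_asg_open_cell d N (asg : 'rV[R]_d -> 'I_d -> 'I_N) x j k :
  valid_asg asg -> cubeX x ->
  k%:R / N%:R < x ord0 j < k.+1%:R / N%:R -> asg x j = k :> nat.
Proof.
move=> va x01 /andP[kx xk]; have /andP[ax xa] := va x x01 j.
have N0R : 0 < N%:R :> R by rewrite ltr0n (leq_ltn_trans _ (ltn_ord (asg x j))).
have := le_lt_trans ax xk; rewrite ltr_pM2r ?invr_gt0// ltr_nat ltnS => ak.
have := lt_le_trans kx xa; rewrite ltr_pM2r ?invr_gt0// natr1 ltr_nat ltnS => ka.
by apply/eqP; rewrite eqn_leq ak ka.
Qed.

(** Away from the walls the first cell index is forced by the first coordinate, so the outer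
    integrand is a step function whatever the choice on the boundaries. *)
Lemma cint_center d N (h : 'rV[R]_d -> R) (asg : 'rV[R]_d -> 'I_d -> 'I_N) :
  (0 < N)%N -> valid_asg asg ->
  cint (fun x => (h (@Defs.center R d N (asg x)))%:E) = (csum N h)%:E.
Proof.
move=> N0; elim: d h asg => [h asg _|d ih h asg va] /=.
  by congr ((h _)%:E); apply/rowP => -[].
rewrite -/(cint _).
apply: (integral_cells_step (v := fun k => csum N (fun y => h (consv (cellc R N k) y)))) => //.
move=> k t kN kt.
have t01 : 0 <= t <= 1.
  by apply: (cell_sub_unit kN); case/andP: kt => /ltW -> /ltW ->.
(* Freezing the first coordinate at [t] leaves a valid assignment for the others. *)
pose asg' (y : 'rV[R]_d) (j : 'I_d) := asg (consv t y) (lift ord0 j).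
have va' : valid_asg asg'.
  move=> y y01 j; have := va (consv t y) _ (lift ord0 j).
  by rewrite consvS; apply; exact/cubeX_consv.
rewrite -(ih (fun y => h (consv (cellc R N k) y)) asg' va').
apply: eq_cint => y y01; congr ((h _)%:E).
have cy : cubeX (consv t y) by exact/cubeX_consv.
apply: eq_consv => [|j]; rewrite !mxE//.
by rewrite (valid_asg_open_cell va cy (k := k)) ?consv0.
Qed.

Lemma cubeX_center d N (k : 'I_d -> 'I_N) : cubeX (@Defs.center R d N k).
Proof. by move=> j; rewrite mxE; exact: cellc_itv. Qed.

Lemma Zf_gn d N (f : 'rV[R]_d -> R) (asg : 'rV[R]_d -> 'I_d -> 'I_N) :
  (0 < N)%N -> valid_asg asg -> Zf (gn asg f) = csum N (expR \o f).
Proof. by move=> N0 va; rewrite /Zf (cint_center (expR \o f) N0 va). Qed.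

(** Both sandwich bounds are finite, so [fine] loses nothing. *)
Lemma Zf_EFin N e d (f : 'rV[R]_d -> R) :
  lines (fun phi => sandwich N e (expR \o phi)) f ->
  (Zf f)%:E = cint (fun x => (expR (f x))%:E).
Proof.
move=> /cint_sandwich[lo up]; rewrite /Zf fineK// fin_numE.
by apply/andP; split; apply/eqP => E; [move: lo|move: up]; rewrite E.
Qed.

Lemma Zf_sandwich N e d (f : 'rV[R]_d -> R) :
  lines (fun phi => sandwich N e (expR \o phi)) f ->
  expR (- (d%:R * e)) * csum N (expR \o f) <= Zf f <=
  expR (d%:R * e) * csum N (expR \o f).
Proof.
move=> lf; have [lo up] := cint_sandwich lf.
by rewrite -!lee_fin (Zf_EFin lf) lo up.
Qed.

Lemma csum_exp_gt0 N d (f : 'rV[R]_d -> R) : (0 < N)%N -> 0 < csum N (expR \o f).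
Proof. by move=> N0; apply: csum_gt0 => // x; exact: expR_gt0. Qed.

Lemma Zf_gt0 N e d (f : 'rV[R]_d -> R) : (0 < N)%N ->
  lines (fun phi => sandwich N e (expR \o phi)) f -> 0 < Zf f.
Proof.
move=> N0 /Zf_sandwich/andP[+ _]; apply: lt_le_trans.
by rewrite mulr_gt0 ?expR_gt0// csum_exp_gt0.
Qed.

Lemma Lf_dist N e d (f : 'rV[R]_d -> R) (asg : 'rV[R]_d -> 'I_d -> 'I_N) :
  (0 < N)%N -> valid_asg asg ->
  lines (fun phi => sandwich N e (expR \o phi)) f ->
  `|Lf f - Lf (gn asg f)| <= d%:R * e.
Proof.
move=> N0 va lf; have /andP[lo up] := Zf_sandwich lf.
rewrite /Lf (Zf_gn _ N0 va).
have S0 := csum_exp_gt0 f N0; have Z0 := Zf_gt0 N0 lf.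
have : ln (expR (- (d%:R * e)) * csum N (expR \o f)) <= ln (Zf f).
  by rewrite ler_ln ?posrE// mulr_gt0 ?expR_gt0.
have : ln (Zf f) <= ln (expR (d%:R * e) * csum N (expR \o f)).
  by rewrite ler_ln ?posrE// mulr_gt0 ?expR_gt0.
rewrite !lnM ?posrE ?expR_gt0// !expRK => {}up {}lo.
by rewrite ler_norml; apply/andP; split; lra.
Qed.

(** Coordinates are moved one at a time, each at cost at most [B * w], through points of the
    cube. *)
Lemma lines_lipschitz_dist d B w (f : 'rV[R]_d -> R) x y : 0 < B ->
  lines (lipschitz01 B) f -> cubeX x -> cubeX y ->
  (forall j, `|x ord0 j - y ord0 j| <= w) -> `|f x - f y| <= d%:R * (B * w).
Proof.
move=> B0; elim: d f x y => [f x y _ _ _ _|d ih f x y lf].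
  have -> : x = y by apply/rowP => -[].
  by rewrite subrr normr0 mul0r.
rewrite (consv_surj x) (consv_surj y); move: (x _ _) (\row_j _) => s u.
move: (y _ _) (\row_j _) => t v /cubeX_consv[s01 u01] /cubeX_consv[t01 v01] xy.
have h1 : `|f (consv s u) - f (consv t u)| <= B * w.
  apply: le_trans (lines_head lf u01 _ _ s01 t01) _.
  by rewrite ler_wpM2l ?(ltW B0)//; have := xy ord0; rewrite !consv0.
have h2 : `|f (consv t u) - f (consv t v)| <= d%:R * (B * w).
  apply: (ih (fun y => f (consv t y))) => //; first exact: lines_slice.
  by move=> j; have := xy (lift ord0 j); rewrite !consvS.
have -> : f (consv s u) - f (consv t v) =
  (f (consv s u) - f (consv t u)) + (f (consv t u) - f (consv t v)) by ring.
have := lerD h1 h2; rewrite -natr1 mulrDl mul1r [d%:R * _ + _]addrC.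
by apply: le_trans; exact: ler_normD.
Qed.

Lemma gn_dist d N B (f : 'rV[R]_d -> R) (asg : 'rV[R]_d -> 'I_d -> 'I_N) x :
  (0 < N)%N -> 0 < B -> valid_asg asg -> lines (lipschitz01 B) f -> cubeX x ->
  `|f x - gn asg f x| <= d%:R * (B / (2 * N%:R)).
Proof.
move=> N0 B0 va lf x01; apply: lines_lipschitz_dist => //; first exact: cubeX_center.
move=> j; rewrite mxE; apply: (@cell_dist R N (asg x j)); first exact: ltn_ord.
by have := va x x01 j; rewrite natr1.
Qed.

Lemma ln_densP_ratio d (f g : 'rV[R]_d -> R) x : 0 < Zf f -> 0 < Zf g ->
  ln (densP f x / densP g x) = f x - g x - (Lf f - Lf g).
Proof.
move=> Zf0 Zg0; rewrite /densP /Lf.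
have p (h : 'rV[R]_d -> R) : 0 < Zf h -> 0 < expR (h x) / Zf h.
  by move=> Zh0; rewrite divr_gt0 ?expR_gt0.
rewrite ln_div ?posrE ?p// !ln_div ?posrE ?expR_gt0// !expRK.
ring.
Qed.

Lemma Dsuplog_le d (f g : 'rV[R]_d -> R) (c : R) :
  (forall x, cubeX x -> `|ln (densP f x / densP g x)| <= c) ->
  (Dsuplog f g <= c%:E)%E.
Proof.
move=> H; apply: ereal_inf_lbound; exists c => //=.
rewrite (@eq_cint d _ (fun=> 0%:E)) ?cint_cst// => x /H cx.
rewrite indicE memNset//=; apply/negP; rewrite -leNgt.
exact: cx.
Qed.

End Cube.

(** * Smooth functions along coordinate lines *)

Section CoordinateLines.
Variable R : realType.
Implicit Types (d : nat) (B : R).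

Lemma cubeXo_upd d (x : 'rV[R]_d) j s : cubeXo x -> 0 < s < 1 -> cubeXo (upd x j s).
Proof. by move=> x01 s01 i; rewrite updE; case: eqP. Qed.

Lemma cubeX_upd d (x : 'rV[R]_d) j s : cubeX x -> 0 <= s <= 1 -> cubeX (upd x j s).
Proof. by move=> x01 s01 i; rewrite updE; case: eqP. Qed.

Lemma upd_shift d (x : 'rV[R]_d) j s h :
  upd x j (h + s) = h *: evec R j + upd x j s.
Proof.
apply/rowP => i; rewrite !mxE eqxx/=; case: eqP => _.
  by rewrite mulr1.
by rewrite mulr0 add0r.
Qed.

Lemma is_derive_line d (F : 'rV[R]_d -> R) x j s :
  derivable F (upd x j s) (evec R j) ->
  is_derive s (1 : R) (fun t => F (upd x j t)) ('D_(evec R j) F (upd x j s)).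
Proof.
have E : (fun h : R => h^-1 *: (F (upd x j (h *: (1 : R) + s)) - F (upd x j s))) =
   (fun h : R => h^-1 *: (F (h *: evec R j + upd x j s) - F (upd x j s))).
  by apply/funext => h; rewrite [h *: 1]mulr1 upd_shift.
move=> dF; split; first by move: dF; rewrite /derivable -E.
by rewrite /derive -E.
Qed.

(** The distance from [xi] to [t] is recorded because the second-order remainder needs it. *)
Lemma mvt_line d (F : 'rV[R]_d -> R) x j (s t : R) :
  (forall y, cubeXo y -> derivable F y (evec R j)) ->
  cubeXo x -> 0 < s < 1 -> 0 < t < 1 ->
  exists xi, [/\ 0 < xi < 1, `|xi - t| <= `|s - t| &
    F (upd x j s) - F (upd x j t) = 'D_(evec R j) F (upd x j xi) * (s - t)].
Proof.
move=> dF x01; pose psi u := F (upd x j u).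
have dpsi (u : R) : 0 < u < 1 -> is_derive u (1 : R) psi ('D_(evec R j) F (upd x j u)).
  by move=> u01; apply: is_derive_line; apply: dF; exact: cubeXo_upd.
have key (a b : R) : 0 < a < 1 -> 0 < b < 1 -> a < b ->
    exists2 xi, a < xi < b & psi b - psi a = 'D_(evec R j) F (upd x j xi) * (b - a).
  move=> /andP[a0 a1] /andP[b0 b1] ab.
  have [||xi] := @MVT R psi (fun u => 'D_(evec R j) F (upd x j u)) a b ab.
  - move=> u; rewrite in_itv/= => /andP[au ub]; apply: dpsi.
    by rewrite (lt_trans a0 au) (lt_trans ub b1).
  - apply: derivable_within_continuous => u; rewrite in_itv/= => /andP[au ub].
    have [] // := dpsi u _.
    by rewrite (lt_le_trans a0 au) (le_lt_trans ub b1).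
  - by rewrite in_itv/=; exists xi.
move=> s01 t01; have [st|ts|->] := ltgtP s t.
- have [xi /andP[sx xt] E] := key s t s01 t01 st.
  exists xi; split.
  + by case/andP: s01 t01 => s0 _ /andP[_ t1]; rewrite (lt_trans s0 sx) (lt_trans xt t1).
  + by rewrite !ltr0_norm ?subr_lt0//; lra.
  + by move: E; rewrite /psi => E; rewrite -opprB E; ring.
- have [xi /andP[tx xs] E] := key t s t01 s01 ts.
  exists xi; split => //.
  + by case/andP: t01 s01 => t0 _ /andP[_ s1]; rewrite (lt_trans t0 tx) (lt_trans xs s1).
  + by rewrite !gtr0_norm ?subr_gt0//; lra.
- by exists t; split => //; rewrite !subrr mulr0.
Qed.

Lemma lipschitz_interior d (F : 'rV[R]_d -> R) B x j (s t : R) :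
  (forall y, cubeXo y -> derivable F y (evec R j)) ->
  (forall y, cubeXo y -> `|'D_(evec R j) F y| <= B) ->
  cubeXo x -> 0 < s < 1 -> 0 < t < 1 ->
  `|F (upd x j s) - F (upd x j t)| <= B * `|s - t|.
Proof.
move=> dF DB x01 s01 t01; have [xi [xi01 _ ->]] := mvt_line dF x01 s01 t01.
by rewrite normrM ler_wpM2r// DB//; exact: cubeXo_upd.
Qed.

(* Derivatives are only controlled inside the cube; bounds on the closed cube follow by
   letting [n] tend to infinity in the contraction [shrink n] towards the center. *)
Definition shrink1 (n : nat) (s : R) : R := s + harmonic n * (2^-1 - s).

Definition shrink d (n : nat) (x : 'rV[R]_d) : 'rV[R]_d :=
  x + harmonic n *: (const_mx 2^-1 - x).

Lemma shrinkE d n (x : 'rV[R]_d) j : shrink n x ord0 j = shrink1 n (x ord0 j).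
Proof. by rewrite !mxE. Qed.

Lemma shrink_upd d n (x : 'rV[R]_d) j s :
  shrink n (upd x j s) = upd (shrink n x) j (shrink1 n s).
Proof.
by apply/rowP => i; rewrite updE !shrinkE updE; case: eqP.
Qed.

Lemma shrink1_itv n s : 0 <= s <= 1 -> 0 < shrink1 n s < 1.
Proof.
move=> /andP[s0 s1]; rewrite /shrink1 /harmonic/=.
have n0 : 0 < n.+1%:R :> R by [].
have l0 : 0 < n.+1%:R^-1 :> R by rewrite invr_gt0.
have l1 : n.+1%:R^-1 <= 1 :> R by rewrite invf_le1// ler1n.
move: l0 l1; move: (n.+1%:R^-1) => l l0 l1.
have : 0 <= (1 - l) * s by rewrite mulr_ge0// subr_ge0.
have : 0 <= (1 - l) * (1 - s) by rewrite mulr_ge0// subr_ge0.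
by move=> ? ?; apply/andP; split; lra.
Qed.

Lemma shrink_interior d n (x : 'rV[R]_d) : cubeX x -> cubeXo (shrink n x).
Proof. by move=> x01 j; rewrite shrinkE; exact: shrink1_itv. Qed.

Lemma cubeXo_sub d (x : 'rV[R]_d) : cubeXo x -> cubeX x.
Proof. by move=> x01 j; have /andP[/ltW -> /ltW ->] := x01 j. Qed.

Lemma shrink1B n s t : shrink1 n s - shrink1 n t = (1 - harmonic n) * (s - t).
Proof. by rewrite /shrink1; ring. Qed.

Lemma shrink1B_le n s t : `|shrink1 n s - shrink1 n t| <= `|s - t|.
Proof.
rewrite shrink1B normrM -[leRHS]mul1r ler_wpM2r//.
have l0 : 0 < n.+1%:R^-1 :> R by rewrite invr_gt0.
have l1 : n.+1%:R^-1 <= 1 :> R by rewrite invf_le1// ler1n.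
by rewrite /harmonic/= ger0_norm ?subr_ge0// lerBlDr lerDl ltW.
Qed.

Lemma shrink1B_cvg s t : (shrink1 n s - shrink1 n t) @[n --> \oo] --> s - t.
Proof.
under eq_fun do rewrite shrink1B.
suff : (1 - harmonic n : R) * (s - t) @[n --> \oo] --> (1 - 0 : R) * (s - t).
  by rewrite subr0 mul1r.
apply: cvgM; last exact: cvg_cst.
by apply: cvgB; [exact: cvg_cst|exact: cvg_harmonic].
Qed.

Lemma shrink_cvg d (x : 'rV[R]_d) : shrink n x @[n --> \oo] --> x.
Proof.
suff : (x + harmonic n *: (const_mx 2^-1 - x)) @[n --> \oo] -->
    x + (0 : R) *: (const_mx 2^-1 - x) by rewrite scale0r addr0.
apply: cvgD; first exact: cvg_cst.
by apply: cvgZr_tmp; exact: cvg_harmonic.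
Qed.

Lemma within_shrink_cvg d (G : 'rV[R]_d -> R) x :
  {within @cubeX R d, continuous G} -> cubeX x ->
  G (shrink n x) @[n --> \oo] --> G x.
Proof.
move=> /subspace_continuousP cG x01 U /(cG x x01) HU.
have {}HU : \forall y \near x, cubeX y -> U (G y) by exact: HU.
have : \forall n \near \oo, cubeX (shrink n x) -> U (G (shrink n x)).
  exact: (@shrink_cvg d x _ HU).
rewrite -[X in _ -> X]/(\forall n \near \oo, U (G (shrink n x))).
apply: filterS => n; apply.
by apply: cubeXo_sub; exact: shrink_interior.
Qed.

Lemma norm_cvg_le (u : nat -> R) (l C : R) :
  u @ \oo --> l -> (forall n, `|u n| <= C) -> `|l| <= C.
Proof.
move=> ul uC; rewrite leNgt; apply/negP => Cl.
have [n] := filter_ex (cvgr_norm_gt _ ul _ Cl).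
by rewrite ltNge uC.
Qed.

(** The mean value theorem gives the bound between shrunken points; [shrink n] does not increase
    distances, and continuity on the closed cube carries the bound to the limit. *)
Lemma inF_lipschitz d m B (f : 'rV[R]_d -> R) : (0 < m)%N ->
  inF m B f -> lines (lipschitz01 B) f.
Proof.
move=> m0 [cf [_ [df Df]]] x x01 j s t s01 t01.
(* [shrink 0 x] is the center of the cube, where [B] bounds an absolute value. *)
have B0 : 0 <= B.
  have [_ /(_ (shrink 0 x) (shrink_interior 0 x01)) h] := Df [::] (leq0n m).
  exact: le_trans h.
apply: (@norm_cvg_le
  (fun n => f (shrink n (upd x j s)) - f (shrink n (upd x j t)))).
  by apply: cvgB; apply: within_shrink_cvg => //; exact: cubeX_upd.
move=> n; rewrite !shrink_upd.
apply: (@le_trans _ _ (B * `|shrink1 n s - shrink1 n t|)); last first.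
  by rewrite ler_wpM2l// shrink1B_le.
apply: lipschitz_interior.
- by move=> y y01; exact: (df [::]).
- by move=> y y01; have [_] := Df [:: j] m0; apply.
- exact: shrink_interior.
- exact: shrink1_itv.
- exact: shrink1_itv.
Qed.

(** A mean value point [xi] turns the remainder into the change of the derivative from [c] to [xi],
    times [s - c]. The derivative is itself [B]-Lipschitz, and [xi] is no farther from [c] than [s]
    is. *)
Lemma inF_taylor d m B (f : 'rV[R]_d -> R) : (1 < m)%N ->
  inF m B f -> lines (taylor01 B) f.
Proof.
move=> m1 [cf [_ [df Df]]] x x01 j c c01.
have [[G [cG GE]] DB] := Df [:: j] (ltnW m1).
have B0 : 0 <= B by apply: le_trans (DB _ (shrink_interior 0 x01)).
have xc01 := cubeX_upd j x01 c01.
(* The slope is the continuous extension of the partial derivative, since [c] may be 0 or 1. *)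
exists (G (upd x j c)).
  apply: (@norm_cvg_le (fun n => G (shrink n (upd x j c)))).
    exact: within_shrink_cvg.
  by move=> n; rewrite GE ?DB//; exact: shrink_interior.
move=> s s01.
apply: (@norm_cvg_le (fun n => f (shrink n (upd x j s)) - f (shrink n (upd x j c))
   - G (shrink n (upd x j c)) * (shrink1 n s - shrink1 n c))).
  apply: cvgB.
    by apply: cvgB; apply: within_shrink_cvg => //; exact: cubeX_upd.
  by apply: cvgM; [exact: within_shrink_cvg|exact: shrink1B_cvg].
move=> n; rewrite GE; last exact: shrink_interior.
have sn := shrink1_itv n s01; have cn := shrink1_itv n c01.
have xn := shrink_interior n x01.
rewrite !shrink_upd.
have [|xi [xi01 xic ->]] := @mvt_line d f (shrink n x) j _ _ _ xn sn cn.
  by move=> y y01; exact: (df [::] j (ltnW m1)).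
rewrite -mulrBl normrM -[_ ^+ 2]real_normK ?num_real// expr2 mulrA.
apply: ler_pM => //; last exact: shrink1B_le.
apply: (@le_trans _ _ (B * `|xi - shrink1 n c|)).
  apply: (@lipschitz_interior d (pder [:: j] f)) => //.
  - by move=> y y01; exact: (df [:: j]).
  - by move=> y y01; have [_] := Df [:: j; j] m1; apply.
by rewrite ler_wpM2l//; apply: le_trans xic (shrink1B_le _ _ _).
Qed.

End CoordinateLines.

(** * Lower bounds *)

Section FirstCoordinate.
Variable R : realType.
Notation mu := (@lebesgue_measure R).
Implicit Types (d m N : nat) (B : R).

Lemma is_derive_first d (g : R -> R) (g' : R) (x : 'rV[R]_d.+1) (i : 'I_d.+1) :
  is_derive (x ord0 ord0) (1 : R) g g' ->
  is_derive x (evec R i) (fun y : 'rV[R]_d.+1 => g (y ord0 ord0))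
    (if i == ord0 then g' else 0).
Proof.
move=> [dg <-].
have [->|i0] := eqVneq i ord0.
  have E : (fun h : R => h^-1 *: (g (h *: (1 : R) + x ord0 ord0) - g (x ord0 ord0))) =
      (fun h : R => h^-1 *: (g ((h *: evec R (@ord0 d) + x) ord0 ord0) - g (x ord0 ord0))).
    by apply/funext => h; rewrite !mxE !eqxx.
  by split; [move: dg; rewrite /derivable E|rewrite /derive E].
have E : (fun h : R => h^-1 *: (g ((h *: evec R i + x) ord0 ord0) - g (x ord0 ord0))) =
    cst 0.
  apply/funext => h.
  by rewrite !mxE eqxx/= eq_sym (negbTE i0) mulr0 add0r subrr scaler0.
split; rewrite /derivable /derive /=.
  by rewrite E; apply/cvg_ex; exists 0; exact: cvg_cst.
by rewrite E; apply: cvg_lim => //; exact: cvg_cst.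
Qed.

(** [D k] plays the [k]-th derivative of the profile [D 0]; one differentiation in another direction
    makes everything vanish. *)
Lemma pder_first d m (D : nat -> R -> R) (s : seq 'I_d.+1) :
  (forall k x, (k < m)%N -> is_derive x (1 : R) (D k) (D k.+1 x)) ->
  (size s <= m)%N ->
  pder s (fun x : 'rV[R]_d.+1 => D 0%N (x ord0 ord0)) =
  fun x => if all (pred1 ord0) s then D (size s) (x ord0 ord0) else 0.
Proof.
move=> dD; elim: s => [//|i s ih] /= sm; apply/funext => x.
rewrite ih ?(ltnW sm)//; case: (all (pred1 ord0) s); last first.
  by rewrite andbF derive_cst.
by rewrite andbT; have [] := is_derive_first i (dD (size s) (x ord0 ord0) sm).
Qed.

Lemma inF_first d m B (D : nat -> R -> R) : 0 <= B ->
  (forall k x, (k < m)%N -> is_derive x (1 : R) (D k) (D k.+1 x)) ->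
  (forall k, (k <= m)%N -> continuous (D k)) ->
  (forall k x, (k <= m)%N -> 0 <= x <= 1 -> `|D k x| <= B) ->
  inF m B (fun x : 'rV[R]_d.+1 => D 0%N (x ord0 ord0)).
Proof.
move=> B0 dD cD DB.
have cont k : (k <= m)%N ->
    {within @cubeX R d.+1, continuous (fun x : 'rV[R]_d.+1 => D k (x ord0 ord0))}.
  move=> km; apply: continuous_subspaceT => x.
  apply: (@continuous_comp _ _ _ (fun x : 'rV[R]_d.+1 => x ord0 ord0)).
    exact: coord_continuous.
  exact: cD.
split; first exact: cont.
split; first by move=> x x01; apply: DB => //; have := x01 ord0.
split.
  move=> s i sm x x01; rewrite (pder_first dD (ltnW sm)).
  case: all; last exact: derivable_cst.
  by have [] := is_derive_first i (dD (size s) (x ord0 ord0) sm).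
move=> s sm; rewrite (pder_first dD sm); split.
  exists (fun x => if all (pred1 ord0) s then D (size s) (x ord0 ord0) else 0).
  split => //; case: all; first by apply: cont.
  by apply: continuous_subspaceT; exact: cst_continuous.
move=> x x01; case: all; last by rewrite normr0.
by apply: DB => //; have := cubeXo_sub x01 ord0.
Qed.

Lemma inF_sandwich d m N B (f : 'rV[R]_d -> R) : (0 < N)%N -> 0 < B -> (0 < m)%N ->
  inF m B f -> lines (fun phi => sandwich N (B / (2 * N%:R)) (expR \o phi)) f.
Proof.
move=> N0 B0 m0 /(inF_lipschitz m0) lf x x01 j.
exact: sandwich_lipschitz (lf x x01 j).
Qed.

(** The remaining coordinates contribute a factor 1 to both the integral and the midpoint sum, which
    leaves a one-dimensional comparison. *)
Lemma Lf_first_ge d m N B eta (psi : R -> R)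
    (asg : 'rV[R]_d.+1 -> 'I_d.+1 -> 'I_N) :
  (0 < N)%N -> 0 < B -> (0 < m)%N -> valid_asg asg ->
  inF m B (fun x : 'rV[R]_d.+1 => psi (x ord0 ord0)) ->
  ((expR eta * midsum N (expR \o psi))%:E <=
    \int[mu]_(t in `[0%R, 1%R]) (expR (psi t))%:E)%E ->
  eta <= Lf (fun x : 'rV[R]_d.+1 => psi (x ord0 ord0)) -
         Lf (gn asg (fun x : 'rV[R]_d.+1 => psi (x ord0 ord0))).
Proof.
move=> N0 B0 m0 va /(inF_sandwich N0 B0 m0) lf.
rewrite -(cint_first d (expR \o psi)) -(Zf_EFin lf) lee_fin => H.
have S0 : 0 < midsum N (expR \o psi).
  by apply: midsum_gt0 => // k _; exact: expR_gt0.
rewrite /Lf (Zf_gn _ N0 va) (csum_first _ (expR \o psi) N0).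
have : ln (expR eta * midsum N (expR \o psi)) <=
    ln (Zf (fun x : 'rV[R]_d.+1 => psi (x ord0 ord0))).
  have Z0 := Zf_gt0 N0 lf.
  by rewrite ler_ln// ?posrE// mulr_gt0 ?expR_gt0.
by rewrite lnM ?posrE ?expR_gt0// expRK lerBrDr.
Qed.

(** The derivatives of [x + x ^+ 2] are at most 3 on [0, 1], so [B / 3] puts it in the class for
    every [m]. Its curvature produces the term [B] of the lower bound, and its slope, at least 1,
    the term [B ^+ 2]. *)
Definition quadD B (k : nat) (x : R) : R :=
  match k with
  | 0 => B / 3 * (x + x ^+ 2)
  | 1 => B / 3 * (1 + 2 * x)
  | 2 => B / 3 * 2
  | _ => 0
  end.

Lemma inF_quad d m B : 0 < B ->
  inF m B (fun x : 'rV[R]_d.+1 => quadD B 0 (x ord0 ord0)).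
Proof.
move=> B0.
have dD k x : is_derive x (1 : R) (quadD B k) (quadD B k.+1 x).
  case: k => [|[|[|k]]].
  - by apply: is_derive_eq; rewrite ?/GRing.scale/=; ring.
  - by apply: is_derive_eq; rewrite ?/GRing.scale/=; ring.
  - exact: (is_derive_cst (B / 3 * 2)).
  - exact: (is_derive_cst (0 : R)).
apply: (@inF_first d m B (quadD B) (ltW B0)) => [k _ x|k x _ /andP[x0 x1]].
  by apply/differentiable_continuous/derivable1_diffP; have [] := dD k x.
have bx : 0 <= B * x by rewrite mulr_ge0// ltW.
have bx1 : B * x <= B by rewrite ger_pMr.
have bxx : B * x ^+ 2 <= B * x by rewrite ler_pM2l// expr2 ler_piMl.
have bxx0 : 0 <= B * x ^+ 2 by rewrite mulr_ge0 ?sqr_ge0// ltW.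
case: k => [|[|[|k]]] /=; rewrite ?normr0 ?(ltW B0)//.
all: by rewrite ler_norml; apply/andP; split; lra.
Qed.

Lemma quadD_diff B c t :
  quadD B 0 t - quadD B 0 c = B / 3 * (t - c) * (1 + c + t).
Proof. by rewrite /quadD; ring. Qed.

Lemma within_continuous_exp_quad B : {within `[0, 1], continuous (expR \o quadD B 0)}.
Proof.
apply: continuous_subspaceT => x; apply: continuous_comp; last exact: continuous_expR.
apply/differentiable_continuous/derivable1_diffP.
have [] // : is_derive x (1 : R) (quadD B 0) (quadD B 1 x).
by apply: is_derive_eq; rewrite ?/GRing.scale/=; ring.
Qed.

(** For the increment [y] from the cell center, curvature contributes [B / 3 * h ^+ 2] and
    [y ^+ 2 / 4] at least [B ^+ 2 / 36 * h ^+ 2]. The mean gain is at least max(B, B^2)/(12 * 36 *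
    N^2); the constant is half of that, to absorb [expR z <= 1 + 2 * z]. *)
Lemma quad_integral_small N B : (0 < N)%N -> 0 < B -> B / N%:R <= 1 ->
  ((expR (24^-1 / 36 * (Num.max B (B ^+ 2) / N%:R ^+ 2)) *
     midsum N (expR \o quadD B 0))%:E <=
    \int[mu]_(t in `[0%R, 1%R]) (expR (quadD B 0 t))%:E)%E.
Proof.
move=> N0 B0 BN; have N0R : 0 < N%:R :> R by rewrite ltr0n.
have N1 : N%:R^-1 <= 1 :> R by rewrite invf_le1// ler1n.
have iN0 : 0 < N%:R^-1 :> R by rewrite invr_gt0.
pose E k := expR (quadD B 0 (cellc R N k)).
have := @integral_ge_quadratic R N (expR \o quadD B 0) E
  (fun k => E k * (B / 3 * (1 + 2 * cellc R N k)))
  (fun k => E k * (B / 3 + B ^+ 2 / 36)) N0 (@within_continuous_exp_quad B).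
move=> H; apply: le_trans (H _) => {H}; last first.
  move=> k t kN kt; set c := cellc R N k; set h := t - c.
  have /andP[c0 c1] : 0 <= c <= 1 := cellc_itv R kN.
  have /andP[t0 t1] := cell_sub_unit kN kt.
  have hN : `|h| <= (2 * N%:R)^-1 := cell_dist kN kt.
  have yE := quadD_diff B c t; rewrite -/h in yE.
  set y := B / 3 * h * (1 + c + t) in yE.
  have -> : (expR \o quadD B 0) t = E k * expR y.
    by rewrite /comp /E -/c -expRD -yE addrC subrK.
  have -> : E k + E k * (B / 3 * (1 + 2 * c)) * h + E k * (B / 3 + B ^+ 2 / 36) * h ^+ 2
    = E k * (1 + (B / 3 * (1 + 2 * c)) * h + (B / 3 + B ^+ 2 / 36) * h ^+ 2) by ring.
  rewrite ler_wpM2l ?expR_ge0//; apply: le_trans (expR_ge_quadratic _).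
    have -> : y ^+ 2 / 4 = B ^+ 2 / 36 * h ^+ 2 * (1 + c + t) ^+ 2.
      by rewrite /y; field.
    have -> : y = B / 3 * (1 + 2 * c) * h + B / 3 * h ^+ 2.
      by rewrite /y /h; field.
    have : B ^+ 2 / 36 * h ^+ 2 <= B ^+ 2 / 36 * h ^+ 2 * (1 + c + t) ^+ 2.
      rewrite ler_peMr//; first by rewrite mulr_ge0 ?sqr_ge0// divr_ge0 ?sqr_ge0.
      by rewrite expr_ge1//; lra.
    by lra.
  have yb : `|y| <= 1.
    rewrite /y !normrM (gtr0_norm B0) (@ger0_norm _ (1 + c + t)); last by lra.
    rewrite (@gtr0_norm _ 3^-1)//.
    have : B * `|h| <= 2^-1.
      apply: le_trans (ler_wpM2l (ltW B0) hN) _.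
      by rewrite invfM mulrCA -[leRHS]mulr1 ler_wpM2l.
    have : 0 <= B * `|h| by rewrite mulr_ge0// ltW.
    have -> : B / 3 * `|h| * (1 + c + t) = (B * `|h|) * (1 + c + t) / 3 by field.
    by nra.
  by move: yb; rewrite ler_norml => /andP[? _]; lra.
rewrite lee_fin /midsum mulrCA ler_wpM2l ?invr_ge0// mulr_sumr ler_sum// => k _.
have -> : E k + E k * (B / 3 + B ^+ 2 / 36) / (12 * N%:R ^+ 2) =
    E k * (1 + (B / 3 + B ^+ 2 / 36) / (12 * N%:R ^+ 2)).
  by rewrite [RHS]mulrDr mulr1 mulrA.
rewrite -[(expR \o _) _]/(E k) [leLHS]mulrC ler_wpM2l ?expR_ge0//.
set M := Num.max B (B ^+ 2).
have M36 : M / 36 <= B / 3 + B ^+ 2 / 36.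
  have : 0 <= B ^+ 2 by exact: sqr_ge0.
  by rewrite /M; case: (leP B (B ^+ 2)) => *; lra.
have M0 : 0 <= M by rewrite /M le_max ltW.
have MN : M / N%:R ^+ 2 <= 1.
  rewrite /M; case: (leP B (B ^+ 2)) => _.
    by rewrite -expr_div_n exprn_ile1// divr_ge0// ltW.
  by rewrite expr2 invfM mulrA mulr_ile1// ?divr_ge0// ltW.
have iNN : 0 < (N%:R ^+ 2)^-1 :> R by rewrite invr_gt0 exprn_gt0.
have iE : (12 * N%:R ^+ 2)^-1 = 12^-1 * (N%:R ^+ 2)^-1 :> R by rewrite invfM.
rewrite iE; move: MN iNN; move: (N%:R ^+ 2)^-1 => i MN iNN.
have Mi0 : 0 <= M * i by rewrite mulr_ge0// ltW.
set z := _ * (M * i); have zE : z = 24^-1 / 36 * (M * i) by [].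
have z0 : 0 <= z by rewrite zE; lra.
have z1 : z <= 2^-1 by rewrite zE; lra.
apply: le_trans (expR_le_quadratic z1) _.
have zz : z ^+ 2 <= z / 2 by rewrite expr2 ler_wpM2l.
have : M / 36 * i <= (B / 3 + B ^+ 2 / 36) * i by rewrite ler_wpM2r// ltW.
set w := (_ + _) * i.
have -> : (B / 3 + B ^+ 2 / 36) * (12^-1 * i) = w / 12 by rewrite /w; field.
by lra.
Qed.

(* The quadratic correction lies below [s^2] for [s >= 0], is nonpositive for
   [-1.0005 <= s <= 0], and still has positive mean over [-1, 1]. *)
Lemma expR_ge_quadratic_shifted (v s : R) : 0 <= v -> - (1 + 20^-1 / 100) <= s ->
  1 + v * s + v ^+ 2 / 4 * (s ^+ 2 / 10 + s / 10 - 100^-1) <= expR (v * s).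
Proof.
move=> v0 s1; have v2 : 0 <= v ^+ 2 / 4 by rewrite divr_ge0 ?sqr_ge0.
have [s0|s0] := leP 0 s.
  apply: le_trans (expR_ge_quadratic _); last by apply: (le_trans _ (mulr_ge0 v0 s0)).
  rewrite lerD2l exprMn [leRHS]mulrAC ler_wpM2l//.
  (* Completes the square in [9 / 10 * s ^+ 2 - s / 10 + 100^-1], minimal at [18^-1]. *)
  have : 0 <= (s - 18^-1) ^+ 2 by exact: sqr_ge0.
  by rewrite !expr2; lra.
apply: le_trans (expR_ge1Dx _); rewrite gerDl mulr_ge0_le0//.
(* This bounds [s ^+ 2 + s] by [- s / 2000], well below 1/10. *)
have : 0 <= (s + (1 + 20^-1 / 100)) * (- s) by rewrite mulr_ge0//; lra.
by rewrite expr2; lra.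
Qed.

(** To gain a multiple of [B / N%:R] in the exponent, the exponential is expanded slightly to the
    right of each center, which raises [E k] to [V k]. The recentered quadratic still has mean at
    least 1 because [v k] exceeds 1/6. *)
Lemma quad_integral_large N B : (0 < N)%N -> 1 < B / N%:R ->
  ((expR (20^-1 / 100 / 6 * (B / N%:R)) * midsum N (expR \o quadD B 0))%:E <=
    \int[mu]_(t in `[0%R, 1%R]) (expR (quadD B 0 t))%:E)%E.
Proof.
move=> N0 BN; have N0R : 0 < N%:R :> R by rewrite ltr0n.
have B0 : 0 < B by have := lt_trans ltr01 BN; rewrite pmulr_lgt0// invr_gt0.
pose E k := expR (quadD B 0 (cellc R N k)).
(* Slope at the center times the half-width of a cell. *)
pose v k := B / 3 * (1 + 2 * cellc R N k) / (2 * N%:R).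
pose c0 : R := 20^-1 / 100.
pose V k := E k * expR (v k * c0).
(* Coefficients, in powers of [h], of the minorant in [expR_ge_quadratic_shifted] at
   [s = 2 * N%:R * h - c0]. *)
pose A0 k := V k * (1 - v k * c0 + v k ^+ 2 / 4 * (c0 ^+ 2 / 10 - c0 / 10 - 100^-1)).
pose A1 k := V k * (v k + v k ^+ 2 / 4 * (10^-1 - 2 * c0 / 10)) * (2 * N%:R).
pose A2 k := V k * (v k ^+ 2 / 4 / 10) * (2 * N%:R) ^+ 2.
have v6 k : (k < N)%N -> 6^-1 * (B / N%:R) <= v k.
  move=> kN; have /andP[c0' _] := cellc_itv R kN.
  have -> : v k = (1 + 2 * cellc R N k) * (6^-1 * (B / N%:R)).
    by rewrite /v; field; rewrite gt_eqF.
  rewrite ler_peMl//; last by lra.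
  by rewrite mulr_ge0// ltW// (lt_trans ltr01 BN).
have := @integral_ge_quadratic R N (expR \o quadD B 0) A0 A1 A2 N0 (@within_continuous_exp_quad B).
move=> H; apply: le_trans (H _) => {H}; last first.
  move=> k t kN kt; set c := cellc R N k; set h := t - c.
  have hN : `|h| <= (2 * N%:R)^-1 := cell_dist kN kt.
  have v0 : 0 <= v k.
    by apply: le_trans (v6 k kN); rewrite mulr_ge0// ltW// (lt_trans ltr01 BN).
  pose s := 2 * N%:R * h - c0.
  have s1 : - (1 + c0) <= s.
    move: hN; rewrite ler_norml => /andP[+ _].
    rewrite -(ler_pM2l (_ : 0 < 2 * N%:R)) ?mulr_gt0// mulrN divff ?gt_eqF ?mulr_gt0//.
    by rewrite /s; lra.
  have -> : A0 k + A1 k * h + A2 k * h ^+ 2 =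
    V k * (1 + v k * s + v k ^+ 2 / 4 * (s ^+ 2 / 10 + s / 10 - 100^-1)).
    by rewrite /A0 /A1 /A2 /s; field.
  apply: (@le_trans _ _ (V k * expR (v k * s))).
    by rewrite ler_wpM2l ?expR_ge_quadratic_shifted// mulr_ge0 ?expR_ge0.
  rewrite /V /E -/c -!expRD ler_expR.
  have : quadD B 0 t - quadD B 0 c = v k * (2 * N%:R) * h + B / 3 * h ^+ 2.
    by rewrite quadD_diff /v /h -/c; field; rewrite gt_eqF.
  (* The curvature term only helps and is dropped. *)
  have : 0 <= B / 3 * h ^+ 2 by rewrite mulr_ge0 ?sqr_ge0// divr_ge0// ltW.
  rewrite /s; move: (quadD B 0 t) (quadD B 0 c) (B / 3 * h ^+ 2) => a b e.
  by lra.
rewrite lee_fin /midsum mulrCA ler_wpM2l ?invr_ge0// mulr_sumr ler_sum// => k _.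
have vk := v6 k (ltn_ord k).
have -> : A0 k + A2 k / (12 * N%:R ^+ 2) =
  V k * (1 + v k * (v k * (4^-1 * (30^-1 - 100^-1 + c0 ^+ 2 / 10 - c0 / 10)) - c0)).
  by rewrite /A0 /A2; field; rewrite gt_eqF.
rewrite -[(expR \o _) _]/(E k) [leLHS]mulrC /V -[leRHS]mulrA ler_wpM2l ?expR_ge0//.
apply: (@le_trans _ _ (expR (v k * c0))).
  by rewrite ler_expR /c0; lra.
rewrite ler_peMr ?expR_ge0// lerDl mulr_ge0//; first by lra.
by rewrite /c0 expr2; lra.
Qed.

End FirstCoordinate.

(** * Cosine test function and lower bound for the density ratio *)

Section Extremals.
Variable R : realType.
Notation mu := (@lebesgue_measure R).
Implicit Types (d m N : nat) (B : R).

(* Only [k = 0] and its derivative [k = 1] are meaningful. *)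
Definition cosD (A w : R) (k : nat) (x : R) : R :=
  match k with 0 => A * cos (w * x) | _ => - (A * w) * sin (w * x) end.

Lemma is_derive_mul_cst (w x : R) : is_derive x (1 : R) ( *%R w) w.
Proof. by apply: is_derive_eq; rewrite /GRing.scale/= mulr1. Qed.

Lemma is_derive_cosD (A w x : R) : is_derive x (1 : R) (cosD A w 0) (cosD A w 1 x).
Proof.
have dc := is_derive1_comp (is_derive_cos (w * x)) (is_derive_mul_cst w x).
have := is_deriveZ A dc; rewrite /GRing.scale/=.
by have -> : A * (- sin (w * x) * w) = cosD A w 1 x by rewrite /cosD; ring.
Qed.

Lemma is_derive_sinD (A w x : R) : w != 0 ->
  is_derive x (1 : R) (fun y => y + A / w * sin (w * y)) (1 + cosD A w 0 x).
Proof.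
move=> w0.
have ds := is_derive1_comp (is_derive_sin (w * x)) (is_derive_mul_cst w x).
have := is_deriveD (is_derive_id x (1 : R)) (is_deriveZ (A / w) ds).
rewrite /GRing.scale/=.
by have -> : A / w * (cos (w * x) * w) = cosD A w 0 x by rewrite /cosD; field.
Qed.

Lemma cosD_continuous (A w : R) k : continuous (cosD A w k).
Proof.
move=> x; case: k => [|k].
  apply/differentiable_continuous/derivable1_diffP.
  by have [] := is_derive_cosD A w x.
apply: (@continuousM _ _ (cst (- (A * w))) (sin \o ( *%R w))); first exact: cst_continuous.
apply: continuous_comp; last exact: continuous_sin.
apply/differentiable_continuous/derivable1_diffP.
by have [] := is_derive_mul_cst w x.
Qed.

(** The derivative is bounded by amplitude times frequency, [B * (pi / 4)], hence by [B] since
    [pi < 4]. *)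
Lemma inF_cos d N B : (0 < N)%N -> 0 < B ->
  inF 1 B (fun x : 'rV[R]_d.+1 =>
    cosD (B / (8 * N%:R)) (pi *+ 2 * N%:R) 0 (x ord0 ord0)).
Proof.
move=> N0 B0; have N0R : 0 < N%:R :> R by rewrite ltr0n.
have N1 : N%:R^-1 <= 1 :> R by rewrite invf_le1// ler1n.
set A := B / _; set w := _ * N%:R.
have A0 : 0 <= A by rewrite divr_ge0 ?ltW// mulr_gt0.
have AB : A <= B.
  have : B * N%:R^-1 <= B by rewrite ger_pMr.
  have : 0 <= B * N%:R^-1 by rewrite divr_ge0// ltW.
  by rewrite /A invfM mulrCA; lra.
have pi4 : pi < 4 :> R by have := pihalf_lt2 R; lra.
have p0 := pi_ge0 R.
have w0 : 0 <= w by rewrite /w mulr_ge0// mulrn_wge0.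
have AwB : A * w <= B.
  have -> : A * w = B * (pi / 4).
    by rewrite /A /w -mulr_natr; field; rewrite gt_eqF.
  by rewrite ger_pMr//; lra.
apply: (@inF_first R d 1 B (cosD A w) (ltW B0)).
- by case=> // x _; exact: is_derive_cosD.
- by move=> k _; exact: cosD_continuous.
- case=> [|k] x _ _ /=.
    rewrite normrM (ger0_norm A0); apply: le_trans AB.
    by rewrite ler_piMr// cos_max.
  have Aw0 : 0 <= A * w by rewrite mulr_ge0.
  rewrite normrM normrN (ger0_norm Aw0); apply: le_trans AwB.
  by rewrite ler_piMr// sin_max.
Qed.

Lemma cosD_cellc (A : R) N k : (0 < N)%N ->
  cosD A (pi *+ 2 * N%:R) 0 (cellc R N k) = - A.
Proof.
move=> N0; have N0R : N%:R != 0 :> R by rewrite pnatr_eq0 -lt0n.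
rewrite /cosD /cellc.
have -> : pi *+ 2 * N%:R * ((k%:R + 2^-1) / N%:R) = pi + (pi *+ 2) *+ k :> R.
  by rewrite -[in RHS](mulr_natr (pi *+ 2 : R) k); field.
by rewrite (periodicn (@cosD2pi R)) cospi mulrN1.
Qed.

(** The midpoint rule sees only the value [- A], so the left side is 1. On the right, [1 + cosD]
    minorizes the exponential, and the cosine integrates to zero over [N] full periods. *)
Lemma cos_integral_ge (A : R) N : (0 < N)%N ->
  ((expR A * midsum N (expR \o cosD A (pi *+ 2 * N%:R) 0))%:E <=
    \int[mu]_(t in `[0%R, 1%R]) (expR (cosD A (pi *+ 2 * N%:R) 0 t))%:E)%E.
Proof.
move=> N0; set w := _ * N%:R.
have w0 : w != 0.
  by rewrite mulf_neq0// ?pnatr_eq0 -?lt0n// mulrn_eq0/= gt_eqF// pi_gt0.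
have -> : expR A * midsum N (expR \o cosD A w 0) = 1.
  rewrite (@eq_midsum _ _ _ (fun=> expR (- A))) ?midsum_cst//.
    by rewrite -expRD subrr expR0.
  by move=> k _; rewrite /comp cosD_cellc.
have := @integral_ge_ftc R _ _ (expR \o cosD A w 0) 0 1 ltr01
  (fun x => is_derive_sinD A x w0) _ _ (fun x _ => expR_ge1Dx _).
rewrite mulr0 sin0 mulr1 mulr0 addr0 subr0.
have -> : sin w = 0.
  by rewrite /w mulr_natr -[pi *+ 2 *+ N]add0r (periodicn (@sinD2pi R)) sin0.
rewrite mulr0 addr0; apply.
- move=> x; apply: cvgD; first exact: cvg_cst.
  exact: cosD_continuous.
- apply: continuous_subspaceT => x; apply: continuous_comp.
    exact: cosD_continuous.
  exact: continuous_expR.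
Qed.

Lemma cint_indic_first_gt0 d (S : set 'rV[R]_d.+1) (a b : R) :
  0 <= a -> a < b -> b <= 1 ->
  (forall x, cubeX x -> a < x ord0 ord0 < b -> S x) ->
  (0 < cint (fun x => (\1_S x)%:E))%E.
Proof.
move=> a0 ab b1 HS.
apply: (@lt_le_trans _ _ (cint (fun x : 'rV[R]_d.+1 => (\1_`]a, b[%classic (x ord0 ord0))%:E))).
  rewrite (cint_first d (\1_(`]a, b[%classic : set R))) integral_indic//=.
  rewrite setIidl; last by apply: subset_itv; rewrite bnd_simp.
  by rewrite lebesgue_measure_itv/= lte_fin ab -EFinB lte_fin subr_gt0.
apply: cint_le => x x01; first by rewrite lee_fin indicE.
rewrite lee_fin !indicE ler_nat; case: (boolP (x ord0 ord0 \in _)) => //.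
by move=> /set_mem /=; rewrite in_itv/= => /(HS x x01) /mem_set ->.
Qed.

(** On the first slab the log ratio is the increment from the center minus the constant [Delta]. On
    an outer quarter the increment has size at least B/(12 N): a quarter of a cell times slope
    B/3. *)
Lemma Dsuplog_quad_ge d m N B (asg : 'rV[R]_d.+1 -> 'I_d.+1 -> 'I_N) :
  (0 < N)%N -> 0 < B -> (0 < m)%N -> valid_asg asg ->
  ((12^-1 * (B / N%:R))%:E <=
    Dsuplog (fun x : 'rV[R]_d.+1 => quadD B 0 (x ord0 ord0))
      (gn asg (fun x : 'rV[R]_d.+1 => quadD B 0 (x ord0 ord0))))%E.
Proof.
move=> N0 B0 m0 va; set f := (fun x : 'rV[R]_d.+1 => quadD B 0 (x ord0 ord0)).
have N0R : 0 < N%:R :> R by rewrite ltr0n.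
have lf := inF_sandwich N0 B0 m0 (@inF_quad R d m B B0).
have Zf0 : 0 < Zf f := Zf_gt0 N0 lf.
have Zg0 : 0 < Zf (gn asg f) by rewrite (Zf_gn _ N0 va) csum_exp_gt0.
apply: le_ereal_inf_tmp => _ [c /= Hc <-]; rewrite lee_fin leNgt; apply/negP => cB.
set Delta := Lf f - Lf (gn asg f).
pose i : R := N%:R^-1.
have i0 : 0 < i by rewrite invr_gt0.
have i1 : i <= 1 by rewrite invf_le1// ler1n.
have c0E : cellc R N 0 = i / 2 by rewrite /cellc add0r mulrC.
have Bi0 : 0 < B * i by rewrite mulr_gt0.
have key x : cubeX x -> 0 < x ord0 ord0 < i ->
    ln (densP f x / densP (gn asg f) x) =
    B / 3 * (x ord0 ord0 - i / 2) * (1 + i / 2 + x ord0 ord0) - Delta.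
  move=> x01 xi; rewrite ln_densP_ratio// -/Delta; congr (_ - _).
  rewrite /gn /f mxE (valid_asg_open_cell va x01 (k := 0)) ?mul0r ?mul1r//.
  by rewrite -[X in _ - quadD B 0 X]/(cellc R N 0) c0E quadD_diff.
suff [a [b [a0 ab b1 H]]] : exists a b, [/\ 0 <= a, a < b, b <= i &
    forall x, cubeX x -> a < x ord0 ord0 < b ->
      c < `|ln (densP f x / densP (gn asg f) x)|].
  have := @cint_indic_first_gt0 d [set y | c < `|ln (densP f y / densP (gn asg f) y)|]
    a b a0 ab (le_trans b1 i1) H.
  by rewrite (_ : cint _ = 0%E) ?ltxx//; exact: Hc.
rewrite -/i in cB; clearbody i Delta; clear Hc Zf0 Zg0 lf va c0E N0R.
(* The quarter is chosen so that the increment and [- Delta] do not have opposite signs: leftmost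
   here, rightmost otherwise. *)
have [D0|D0] := leP 0 Delta.
  exists 0, (i / 4); split; rewrite ?lexx//; try lra.
  move=> x x01 /andP[x0 xi]; rewrite key//; last by rewrite x0/=; lra.
  move: (x ord0 ord0) x0 xi => t t0 ti.
  apply: lt_le_trans cB _; rewrite ler0_norm; last first.
    have : 0 <= B * (i / 2 - t) * (1 + i / 2 + t) by rewrite !mulr_ge0//; lra.
    by lra.
  have h1 : B * (i / 4) <= B * (i / 2 - t) by rewrite ler_pM2l//; lra.
  have h2 : B * (i / 2 - t) <= B * (i / 2 - t) * (1 + i / 2 + t).
    by rewrite ler_peMr ?mulr_ge0//; lra.
  by lra.
exists (3 / 4 * i), i; split; rewrite ?lexx//; try lra.
move=> x x01 /andP[x0 xi]; rewrite key//; last by rewrite xi andbT; lra.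
move: (x ord0 ord0) x0 xi => t t0 ti.
have h1 : B * (i / 4) <= B * (t - i / 2) by rewrite ler_pM2l//; lra.
have h2 : B * (t - i / 2) <= B * (t - i / 2) * (1 + i / 2 + t).
  by rewrite ler_peMr ?mulr_ge0//; lra.
apply: lt_le_trans cB _; by rewrite ger0_norm; lra.
Qed.

Lemma powR_natX_inv d N (a : R) : (0 < d)%N ->
  (N ^ d)%:R `^ (- (a / d%:R)) = N%:R `^ (- a) :> R.
Proof.
move=> d0; rewrite natrX -powR_mulrn// -powRrM; congr powR.
by rewrite mulrN mulrCA divff ?mulr1// pnatr_eq0 -lt0n.
Qed.

End Extremals.

(** * Assembly of the three estimates *)

Unset Implicit Arguments.

(* n = N^d, so n^{-1/d} = n `^ (-1/d) and n^{-2/d} = n `^ (-2/d). *)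
Theorem theorem16 (R : realType) (d m : nat) :
  (1 <= d)%N -> (1 <= m)%N ->
  exists c C : R, 0 < c /\ 0 < C /\
  forall (B : R) (N : nat), 0 < B -> (1 <= N)%N ->
  forall asg : 'rV[R]_d -> 'I_d -> 'I_N, valid_asg asg ->
  let n : R := (N ^ d)%N%:R in
  let r1 : R := B * n `^ (- (d%:R)^-1) in
  let r2 : R := Num.max B (B ^+ 2) * n `^ (- (2 / d%:R)) in
  ((m = 1%N \/ 1 < r1) ->
     ((c * r1)%:E <= supL m B asg /\ supL m B asg <= (C * r1)%:E)%E) /\
  (~ (m = 1%N \/ 1 < r1) ->
     ((c * r2)%:E <= supL m B asg /\ supL m B asg <= (C * r2)%:E)%E) /\
  ((c * r1)%:E <= supD m B asg /\ supD m B asg <= (C * r1)%:E)%E.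
Proof.
(* The lower constant, from [quad_integral_large], is below 1/8, 1/864 and 1/12 of the other cases;
   the upper one counts one sandwich factor per coordinate. *)
case: d => // d _ m0; exists (20^-1 / 100 / 6), d.+1%:R.
split; first by rewrite !divr_gt0.
split; first by rewrite ltr0n.
move=> B N B0 N0 asg va n r1 r2; have N0R : 0 < N%:R :> R by rewrite ltr0n.
have r1E : r1 = B / N%:R.
  by rewrite /r1 /n -[d.+1%:R^-1]mul1r powR_natX_inv// powR_inv1.
have r2E : r2 = Num.max B (B ^+ 2) / N%:R ^+ 2.
  by rewrite /r2 /n powR_natX_inv// powRN powR_mulrn.
have r10 : 0 <= r1 by rewrite r1E divr_ge0// ltW.
have r20 : 0 <= r2 by rewrite r2E divr_ge0 ?sqr_ge0// le_max ltW.
clearbody r1 r2; subst r1 r2.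
have supL_ge eta (psi : R -> R) :
    inF m B (fun x : 'rV[R]_d.+1 => psi (x ord0 ord0)) ->
    ((expR eta * midsum N (expR \o psi))%:E <=
      \int[lebesgue_measure]_(t in `[0%R, 1%R]) (expR (psi t))%:E)%E ->
    forall e, e <= eta -> (e%:E <= supL m B asg)%E.
  move=> Fpsi H e ee; have := Lf_first_ge N0 B0 m0 va Fpsi H => h.
  apply: le_trans (ereal_sup_ubound _); last first.
    by exists (fun x : 'rV[R]_d.+1 => psi (x ord0 ord0)).
  by rewrite lee_fin; apply: le_trans ee (le_trans h (ler_norm _)).
have half : B / (2 * N%:R) <= B / N%:R.
  rewrite invfM mulrCA; have : 0 <= B / N%:R by [].
  by lra.
split; [|split].
- move=> c1; split.
    (* For [m = 1] the cosine serves for every [B]; otherwise [B / N%:R] exceeds 1 and the quadratic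
       gains enough. *)
    have [m1|m1] := eqVneq m 1%N.
      rewrite m1 in supL_ge *.
      apply: (supL_ge _ _ (@inF_cos R d N B N0 B0) (cos_integral_ge _ N0)).
      have -> : B / (8 * N%:R) = 8^-1 * (B / N%:R) by rewrite invfM mulrCA.
      by lra.
    have BN : 1 < B / N%:R by case: c1 => // m1'; rewrite m1' in m1.
    exact: (supL_ge _ _ (@inF_quad R d m B B0) (quad_integral_large N0 BN)).
  apply: ge_ereal_sup => _ [f Ff <-]; rewrite lee_fin.
  apply: le_trans (Lf_dist N0 va (inF_sandwich N0 B0 m0 Ff)) _.
  by rewrite ler_wpM2l.
- move=> c2; have BN : B / N%:R <= 1.
    by rewrite leNgt; apply/negP => h; apply: c2; right.
  have m1 : (1 < m)%N.
    by rewrite ltn_neqAle m0 andbT eq_sym; apply/eqP => h; apply: c2; left.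
  split.
    apply: (supL_ge _ _ (@inF_quad R d m B B0) (quad_integral_small N0 B0 BN)).
    by lra.
  apply: ge_ereal_sup => _ [f Ff <-]; rewrite lee_fin.
  apply: (Lf_dist N0 va) => x x01 j.
  apply: sandwich_taylor => //.
    exact: (inF_lipschitz m0 Ff).
  exact: (inF_taylor m1 Ff).
- split.
    apply: le_trans (ereal_sup_ubound _); last first.
      by exists (fun x : 'rV[R]_d.+1 => quadD B 0 (x ord0 ord0)) => //; exact: inF_quad.
    apply: le_trans (Dsuplog_quad_ge N0 B0 m0 va).
    by rewrite lee_fin; lra.
  apply: ge_ereal_sup => _ [f Ff <-]; apply: Dsuplog_le => x x01.
  have lf := inF_sandwich N0 B0 m0 Ff.
  rewrite ln_densP_ratio ?(Zf_gt0 N0 lf)//; last first.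
    by rewrite (Zf_gn _ N0 va) csum_exp_gt0.
  have h1 := gn_dist N0 B0 va (inF_lipschitz m0 Ff) x01.
  have h2 := Lf_dist N0 va lf.
  (* The pointwise error and the normalization error each contribute half of the bound. *)
  apply: le_trans (ler_normB _ _) _; apply: le_trans (lerD h1 h2) _.
  by rewrite -mulrDr ler_wpM2l// invfM mulrCA; lra.
Qed.
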